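(* Every planar graph $G$ with girth at least $5$ and at least two vertices satisfies $\rho_2(G)\ge 1/22$.
   Context: Firefighter process: in a finite simple graph $G$, a fire starts at time $0$ at a vertex $v$. At each subsequent time step, the firefighters first protect at most $k$ vertices that are not burning (protection is permanent), and then the fire spreads from every burning vertex to all its unprotected neighbours. A vertex is saved if it never burns. Let $sn_k(G,v)$ be the maximum number of vertices of $G$ that can be saved when the fire starts at $v$. For a graph $G$ on $n$ vertices, the $k$-surviving rate is $\rho_k(G)=\frac{1}{n^2}\sum_{v\in V(G)} sn_k(G,v)$. The girth of a graph is the length of a shortest cycle (infinite for forests). *)

(* Defs.v *)
From HB Require Import structures.
From mathcomp Require Import all_boot all_order all_algebra.
From mathcomp Require Import all_classical all_reals.
From mathcomp Require Import topology normedtype.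
From mathcomp Require Import Rstruct Rstruct_topology.

Set Implicit Arguments.
Unset Strict Implicit.
Unset Printing Implicit Defensive.

Import Order.TTheory GRing.Theory Num.Theory.
Local Open Scope classical_set_scope.
Local Open Scope ring_scope.

Notation Rpt := (Rdefinitions.R * Rdefinitions.R)%type.

Definition simple_graph (T : finType) (e : rel T) : Prop :=
  symmetric e /\ irreflexive e.

(* Planarity: a drawing in the plane.  Vertices go to distinct points; every
   edge xy is drawn as a Jordan arc (continuous, injective map of [0,1])
   from pos x to pos y whose interior avoids all vertex points; interiors of
   arcs of different edges are disjoint.  (arc x y is the drawing of the edge
   in direction x -> y; arcs of the same unordered edge may meet.) *)
Definition planar (T : finType) (e : rel T) : Prop :=
  exists (pos : T -> Rpt) (arc : T -> T -> Rdefinitions.R -> Rpt),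
    injective pos /\
    (forall x y, e x y ->
       [/\ {within `[0%R, 1%R], continuous (arc x y)},
           {in `[0%R, 1%R] &, injective (arc x y)},
           arc x y 0%R = pos x & arc x y 1%R = pos y]) /\
    (forall x y (t : Rdefinitions.R), e x y -> (0 < t < 1)%R ->
       forall z, arc x y t <> pos z) /\
    (forall x y x' y' (t t' : Rdefinitions.R), e x y -> e x' y' ->
       (0 < t < 1)%R -> (0 < t' < 1)%R -> arc x y t = arc x' y' t' ->
       (x = x' /\ y = y') \/ (x = y' /\ y = x')).

Local Close Scope classical_set_scope.

(* Girth at least g: every cycle (closed walk on >= 3 distinct vertices)
   has length at least g.  Forests (no cycles) satisfy this for all g. *)
Definition girth_ge (T : finType) (e : rel T) (g : nat) : Prop :=
  forall p : seq T, uniq p -> (3 <= size p)%N -> cycle e p -> (g <= size p)%N.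

(* A strategy is a finite sequence of protected sets: s i is the set protected
   at time i+1 (i < #|T|); nothing is protected afterwards.  Since the burning
   set stabilises after at most #|T| - 1 steps, horizon #|T| loses nothing. *)
Definition strategy (T : finType) := {ffun 'I_#|T| -> {set T}}.

Definition prot_at (T : finType) (s : strategy T) (t : nat) : {set T} :=
  match insub t with Some i => s i | None => finset.set0 end.

Definition protected (T : finType) (s : strategy T) (t : nat) : {set T} :=
  \bigcup_(i < t) prot_at s i.

Fixpoint burning (T : finType) (e : rel T) (v : T) (s : strategy T) (t : nat)
  : {set T} :=
  match t with
  | 0 => [set v]
  | t'.+1 =>
      let B := burning e v s t' in
      B :|: [set u | (u \notin protected s t'.+1) && [exists w in B, e w u]]
  end.

Definition valid (T : finType) (e : rel T) (k : nat) (v : T) (s : strategy T)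
  : bool :=
  [forall i : 'I_#|T|, (#|s i| <= k)%N && [disjoint s i & burning e v s i]].

Definition saved (T : finType) (e : rel T) (v : T) (s : strategy T) : {set T} :=
  ~: burning e v s #|T|.

Definition sn (T : finType) (e : rel T) (k : nat) (v : T) : nat :=
  \max_(s : strategy T | valid e k v s) #|saved e v s|.

Definition surviving_rate (T : finType) (e : rel T) (k : nat) : rat :=
  ((\sum_(v : T) sn e k v)%:R / (#|T| ^ 2)%:R)%R.

(* Main.v *)
(** Sparsity.  Subdivide the arcs of a drawing: every vertex takes a piece of
    each of its arcs, so that distinct vertices own disjoint compact connected
    sets joined by short connecting pieces.  By compactness these sets are
    separated, so on a fine enough pixel grid the graph becomes a minor of the
    square grid.  A mod 2 cycle of the graph lifts to the grid, where it is the
    boundary of a set of unit squares, obtained by summing up each column.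
    Call two squares equivalent when no cycle separates them; the boundaries of
    the classes are cycles of the graph, they span its cycle space, and every
    edge lies on at most two of them.  In girth at least 5 a nonzero cycle has
    at least 5 edges, hence 5 (m - n) <= 2 m, i.e. 3 m <= 5 n, for the graph and
    all of its induced subgraphs.

    Firefighting.  Call v good if deg v <= 2, or if deg v = 3 and v has a
    neighbour u of degree at most 3: protecting all the neighbours of v but u,
    and then the other neighbours of u, saves all but two vertices.  Discharging
    the sparsity bound on the vertices of degree at least 2 shows that at least
    n / 15 vertices are good; when n <= 44, saving two vertices from every start
    is already enough. *)
Require Import Defs.
From mathcomp Require Import all_boot all_order all_algebra.
From mathcomp Require Import zify ring.

Set Implicit Arguments.
Unset Strict Implicit.
Unset Printing Implicit Defensive.

(** * Firefighting strategies and discharging *)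

(* [F t] confines the fire up to time [t], and only the first [t0] protected
   sets are used. *)
Lemma sn_ge_contained (T : finType) (e : rel T) (k : nat) (v : T) (p : nat -> {set T})
    (F : nat -> {set T}) (t0 : nat) :
    (t0 <= #|T|)%N ->
    (forall t, #|p t| <= k)%N -> (forall t, [disjoint p t & F t]) ->
    v \in F 0%N ->
    (forall t, F t \subset F t.+1) ->
    (forall t x y, x \in F t -> e x y ->
       (forall i, i <= t -> i < t0 -> y \notin p i)%N -> y \in F t.+1) ->
  (#|T| - #|F #|T| | <= sn e k v)%N.
Proof.
move=> t0T pk pF vF Fmono Fstep.
pose s : strategy T := [ffun i => p (val i)].
have burnF t : burning e v s t \subset F t.
  elim: t => [|t IH] /=; first by rewrite sub1set.
  apply/subsetP => y; rewrite !inE => /orP[/(subsetP IH)/(subsetP (Fmono t)) //|].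
  case/andP => yP /existsP[x /andP[/(subsetP IH) xF xy]].
  apply: Fstep xF xy _ => i it it0; apply: contraNN yP => yi.
  have it' : (i < t.+1)%N by [].
  apply/bigcupP; exists (Ordinal it') => //; rewrite /prot_at /=.
  by rewrite insubT ?(leq_trans it0) // => iT; rewrite ffunE.
have val_s : valid e k v s.
  apply/forallP => i; rewrite ffunE pk /=.
  by apply: disjointWr (pF i); exact: burnF.
apply: leq_trans (_ : #|saved e v s| <= _)%N; last first.
  by rewrite /sn; apply: (@leq_bigmax_cond _ _ (fun s => #|saved e v s|)).
by rewrite /saved [leqRHS]cardsCs setCK leq_sub2l // subset_leq_card.
Qed.

Lemma sn_protect (T : finType) (e : rel T) (k : nat) (v : T) (P : {set T}) :
  (#|P| <= k)%N -> v \notin P -> (#|P| <= sn e k v)%N.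
Proof.
move=> Pk vP.
have T0 : (0 < #|T|)%N by apply/card_gt0P; exists v.
have := @sn_ge_contained T e k v (fun t => if t is 0 then P else set0) (fun=> ~: P) 1 T0.
rewrite [#|~: P|]cardsCs setCK subKn ?max_card //; apply.
- by case=> [|t] //; rewrite cards0.
- by case=> [|t]; rewrite ?disjoints_subset ?setCK ?sub0set.
- by rewrite inE.
- by [].
by move=> t x y _ _ /(_ 0%N isT isT); rewrite inE.
Qed.

Lemma sn_deg_le (T : finType) (e : rel T) (k : nat) (v : T) :
  irreflexive e -> (#|e v| <= k)%N -> (#|T| - 1 <= sn e k v)%N.
Proof.
move=> irr dv.
have T0 : (0 < #|T|)%N by apply/card_gt0P; exists v.
have := @sn_ge_contained T e k v (fun t => if t is 0 then [set y | e v y] else set0)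
   (fun=> [set v]) 1 T0.
rewrite cards1; apply.
- by case=> [|t]; rewrite ?cards0 // cardsE.
- case=> [|t]; rewrite disjoints_subset ?sub0set //.
  by apply/subsetP => y; rewrite !inE; apply: contraTneq => ->; rewrite irr.
- by rewrite inE.
- by [].
by move=> t x y /set1P -> vy /(_ 0%N isT isT); rewrite inE vy.
Qed.

Lemma sn_deg_next (T : finType) (e : rel T) (k : nat) (v u : T) :
  symmetric e -> irreflexive e -> e v u -> (#|e v| <= k.+1)%N -> (#|e u| <= k.+1)%N ->
  (#|T| - 2 <= sn e k v)%N.
Proof.
move=> sym irr vu dv du.
have nvu : v != u by apply: contraTneq vu => ->; rewrite irr.
have T1 : (1 < #|T|)%N by apply/card_gt1P; exists v, u.
have card_nb x y : e x y -> (#|[set z | e x z] :\ y| < #|e x|)%N.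
  move=> xy; rewrite -(cardsE (e x)) (cardsD1 y [set z in e x]) inE.
  rewrite -[y \in e x]/(e x y) xy add1n ltnS; apply: subset_leq_card.
  by apply/subsetP => z; rewrite !inE.
have := @sn_ge_contained T e k v (fun t => match t with 0 => [set y | e v y] :\ u
    | 1 => [set y | e u y] :\ v | _ => set0 end)
   (fun t => if t is 0 then [set v] else [set v; u]) 2 T1.
(* Exposing [#|T|] as a successor makes the confining set at the horizon reduce to [[set v; u]]. *)
case ET : #|T| => [|n]; first by rewrite ET in T1.
rewrite cards2 nvu; apply.
- case=> [|[|t]]; rewrite ?cards0 //; rewrite -ltnS.
    exact: leq_trans (card_nb _ _ vu) dv.
  by apply: leq_trans (card_nb _ _ _) du; rewrite sym.
- case=> [|[|t]]; rewrite disjoints_subset ?sub0set //; apply/subsetP => y; rewrite !inE.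
    by move=> /andP[_]; apply: contraTneq => ->; rewrite irr.
  rewrite negb_or => /andP[-> uy] /=; by apply: contraTneq uy => ->; rewrite irr.
- by rewrite inE.
- by case=> [|t] //; rewrite sub1set !inE eqxx.
case=> [|t] x y.
  move=> /set1P -> vy /(_ 0%N isT isT); rewrite !inE vy andbT negbK => ->.
  by rewrite orbT.
move=> /set2P[] -> xy H.
  have := H 0%N isT isT; rewrite !inE xy andbT negbK => ->; by rewrite orbT.
by have := H 1%N isT isT; rewrite !inE xy andbT negbK => ->.
Qed.

(** Sparsity is assumed on [W] only: a vertex outside [W] takes away at most one edge and so costs
    at most 3 units of charge [3 * dg x - 10], whereas an isolated vertex kept in the count would
    cost 10. *)
Lemma card_le_15_good (T : finType) (e : rel T) (W A : {set T}) :
    symmetric e -> irreflexive e ->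
    W = [set x | 1 < #|e x|]%N ->
    A = [set x | (#|e x| <= 2) || (#|e x| == 3) && [exists y, e x y && (#|e y| <= 3)]]%N ->
    (3 * \sum_(x in W) #|[set y in W | e x y]| <= 10 * #|W|)%N ->
  (#|T| <= 15 * #|A|)%N.
Proof.
move=> sym irr WE AE bnd.
pose dg x := #|e x|.
pose low x := [exists y, e x y && (dg y <= 3)%N].
pose sL := (\sum_x (dg x <= 1))%N.
pose s2 := (\sum_x (dg x == 2))%N.
pose a3 := (\sum_x ((dg x == 3) && low x))%N.
pose b3 := (\sum_x ((dg x == 3) && ~~ low x))%N.
pose b4 := (\sum_x (3 < dg x))%N.
pose D4 := (\sum_x (3 < dg x) * dg x)%N.
have sumE (P : pred T) : (\sum_x P x)%N = #|[set x | P x]|.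
  by rewrite -sum1dep_card [RHS]big_mkcond /=; apply: eq_bigr => x _; case: (P x).
have EW : (#|W| + sL = #|T|)%N.
  rewrite WE -sumE /sL -big_split -[RHS]sum1_card; apply: eq_bigr => x _ /=.
  by rewrite /dg; case: ltnP.
have EA : (#|A| = sL + s2 + a3)%N.
  rewrite AE -sumE /sL /s2 /a3 -!big_split; apply: eq_bigr => x _ /=.
  by rewrite -/(dg x) -/(low x); case: (low x); lia.
have ET : (#|T| = sL + s2 + a3 + b3 + b4)%N.
  rewrite -sum1_card /sL /s2 /a3 /b3 /b4 -!big_split; apply: eq_bigr => x _ /=.
  by case: (low x); lia.
have Edeg : (\sum_(x in W) dg x = 2 * s2 + 3 * a3 + 3 * b3 + D4)%N.
  rewrite big_mkcond /s2 /a3 /b3 /D4 !big_distrr -!big_split; apply: eq_bigr => x _ /=.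
  by rewrite WE inE -/(dg x); case: (low x); case: (dg x) => [|[|[|[|d]]]] //=; lia.
(* The edges leaving [W] are counted from their outer ends, each of degree at most 1. *)
have loss : (\sum_(x in W) dg x <= \sum_(x in W) #|[set y in W | e x y]| + sL)%N.
  have -> : sL = (\sum_(y | y \notin W) 1)%N.
    rewrite /sL [RHS]big_mkcond; apply: eq_bigr => y _ /=.
    by rewrite WE inE -leqNgt; case: (_ <= _)%N.
  apply: (@leq_trans (\sum_(x in W) #|[set y in W | e x y]| +
      \sum_(x in W) \sum_(y | y \notin W) e x y)%N).
    rewrite -big_split; apply: leq_sum => x _ /=.
    rewrite /dg -(cardID (mem W)) leq_add //.
      by apply/subset_leq_card/subsetP => y; rewrite !inE andbC.
    rewrite -sum1_card big_mkcond [leqRHS]big_mkcond; apply: leq_sum => y _.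
    by rewrite !inE -[y \in e x]/(e x y); case: (y \in W) => //=; case: (e x y).
  rewrite leq_add2l exchange_big; apply: leq_sum => y yW /=.
  apply: (@leq_trans (dg y)); last by move: yW; rewrite WE inE -leqNgt.
  rewrite /dg -sum1_card big_mkcond [leqRHS]big_mkcond; apply: leq_sum => x _.
  by rewrite sym -[x \in e y]/(e y x); case: (_ \in _) => //; case: (e y x).
(* With charges [3 * dg x - 10], every vertex counted by [b3] takes 3/7 from each
   of its neighbours, which all have degree at least 4. *)
have b3D4 : (3 * b3 <= D4)%N.
  apply: (@leq_trans (\sum_x \sum_y ((dg x == 3) && ~~ low x) * ((3 < dg y) && e x y))%N).
    rewrite /b3 big_distrr; apply: leq_sum => x _ /=.
    case: (boolP (_ && _)) => [/andP[/eqP d3 nl]|]; last by rewrite muln0.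
    rewrite muln1 -{1}d3 /dg -sum1_card big_mkcond; apply: leq_sum => y _ /=.
    rewrite -[y \in e x]/(e x y); case: (boolP (e x y)) => xy //.
    have : ~~ (dg y <= 3)%N.
      by apply: contraNN nl => dy; apply/existsP; exists y; rewrite xy.
    by rewrite -ltnNge => ->.
  rewrite exchange_big; apply: leq_sum => y _ /=.
  case: ltnP => _; last by rewrite mul0n big1 // => x _; rewrite muln0.
  rewrite mul1n /dg -sum1_card [leqRHS]big_mkcond; apply: leq_sum => x _ /=.
  by rewrite -[x \in e y]/(e y x) (sym y); case: (e x y); case: (_ && _).
have D4b4 : (4 * b4 <= D4)%N.
  rewrite /b4 /D4 big_distrr; apply: leq_sum => x _ /=; lia.
(* Eliminating [D4] with weight 3/7 on [b3D4] and 18/7 on [D4b4] gives [2 * (b3 + b4) <= 7 * (3 * sL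
   + 4 * s2 + a3)], so [b3 + b4] is at most 14 times [#|A|]. *)
lia.
Qed.

(** * Faces of an F_2-cycle space *)

Import GRing.Theory.
Local Open Scope ring_scope.

Lemma F2_eq0Vone (x : 'F_2) : x = 0 \/ x = 1.
Proof. by case: x => [[|[|k]] kP]; [left; apply: val_inj|right; apply: val_inj|]. Qed.

Lemma F2_addxx (x : 'F_2) : x + x = 0.
Proof. by case: (F2_eq0Vone x) => ->; apply: val_inj. Qed.

Lemma F2_oppE (x : 'F_2) : - x = x.
Proof. by case: (F2_eq0Vone x) => ->; apply: val_inj. Qed.

Definition even_chain (T E : finType) (inc : T -> E -> bool) (C : E -> 'F_2) :=
  [forall x, \sum_(i | inc x i) C i == 0].

(* [a i] and [b i] are the faces on the two sides of the edge [i]; the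
   hypotheses say that face boundaries are cycles and span the cycle space. *)
Lemma face_count (T E Q : finType) (inc : T -> E -> bool) (a b : E -> Q)
    (g : nat) :
    (forall C, even_chain inc C ->
       exists S : Q -> 'F_2, forall i, C i = S (a i) + S (b i)) ->
    (forall C, even_chain inc C -> (exists i, C i != 0) ->
       (g <= #|[pred i | C i != 0%R]|)%N) ->
    (forall q, even_chain inc (fun i => (a i == q)%:R + (b i == q)%:R)) ->
  (g * #|E| <= g * #|T| + 2 * #|E|)%N.
Proof.
move=> span girth bnd.
(* The left kernel of [D] is the cycle space; the rows of [F] are the face boundaries. *)
pose D : 'M['F_2]_(#|E|, #|T|) :=
  \matrix_(i, j) (inc (enum_val j) (enum_val i))%:R.
pose F : 'M['F_2]_(#|Q|, #|E|) :=
  \matrix_(q, i) ((a (enum_val i) == enum_val q)%:R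
                  + (b (enum_val i) == enum_val q)%:R).
have sumD (C : E -> 'F_2) x : \sum_(i | inc x i) C i
     = \sum_(i < #|E|) C (enum_val i) * D i (enum_rank x).
  rewrite big_mkcond (reindex (@enum_val E predT)) /=; last exact: (onW_bij _ (enum_val_bij E)).
  by apply: eq_bigr => i _; rewrite mxE enum_rankK; case: (inc _ _); rewrite ?mulr1 ?mulr0.
(* The function [S] of a cycle gives its coefficients on the face boundaries. Hence [\rank F] is at
   least the dimension of the cycle space, which is at least [#|E| - #|T|]. *)
have kerF : (kermx D <= F)%MS.
  apply/row_subP => r; set c := row r _.
  have cD : c *m D = 0 by rewrite -row_mul mulmx_ker row0.
  have [|S SE] := span (fun i => c 0 (enum_rank i)).
    apply/forallP => x; rewrite sumD.
    apply/eqP; transitivity ((c *m D) 0 (enum_rank x)); last by rewrite cD mxE.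
    by rewrite [RHS]mxE; apply: eq_bigr => i _; rewrite enum_valK.
  apply/submxP; exists (\row_q S (enum_val q)).
  apply/rowP => i; rewrite -[i in LHS]enum_valK SE mxE.
  under [RHS]eq_bigr => q _ do rewrite !mxE mulrDr.
  have dl (z : Q) : \sum_(q < #|Q|) S (enum_val q) * (z == enum_val q)%:R = S z.
    rewrite (bigD1 (enum_rank z)) //= enum_rankK eqxx mulr1 big1 ?addr0 // => q nq.
    case: eqP => [zq|]; last by rewrite mulr0.
    by rewrite zq enum_valK eqxx in nq.
  by rewrite big_split /= !dl.
have rkF : (#|E| <= \rank F + #|T|)%N.
  have := mxrankS kerF; rewrite mxrank_ker; have := rank_leq_col D; lia.
(* A maximal independent family of face boundaries: none of them vanishes, so each has at least [g]
   edges, while an edge lies on at most two. Counting incidences in both ways bounds [\rank F * g]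
   by [2 * #|E|]. *)
pose f := maxrankfun F.
have ff : row_free (rowsub f F) by exact: maxrowsub_free.
have big (r : 'I_(\rank F)) : (g <= #|[pred i | F (f r) i != 0%R]|)%N.
  rewrite -(card_imset _ (@enum_val_inj E predT)) /=.
  pose C i : 'F_2 := (a i == enum_val (f r))%:R + (b i == enum_val (f r))%:R.
  have -> : #|[set enum_val i | i in [pred i | F (f r) i != 0%R]]|
     = #|[pred i | C i != 0%R]|.
    apply: eq_card => i; rewrite !inE; apply/imsetP/idP => [[j]|Ci].
      by rewrite inE mxE => jP ->.
    by exists (enum_rank i); rewrite ?inE ?mxE enum_rankK.
  apply: girth (bnd _) _.
  case: (pickP [pred i | C i != 0]) => [i Ci|C0]; first by exists i.
  have /row_freeP[B /matrixP/(_ r r)] := ff.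
  rewrite !mxE eqxx big1 => [/eqP|i _]; first by rewrite eq_sym oner_eq0.
  have /negbFE/eqP := C0 (enum_val i).
  by rewrite /C !mxE => ->; rewrite mul0r.
have small (i : 'I_#|E|) : (#|[pred r | F (f r) i != 0%R]| <= 2)%N.
  rewrite -(card_imset _ (@maxrankfun_inj _ _ _ F)) -(card_imset _ (@enum_val_inj Q predT)) /=.
  apply: leq_trans (_ : #|[set a (enum_val i); b (enum_val i)]| <= 2)%N; last first.
    by rewrite cards2; case: (_ != _).
  apply/subset_leq_card/subsetP => q /imsetP[q' /imsetP[r]]; rewrite inE mxE => + -> ->.
  rewrite !inE.
  case: (eqVneq (a _) _) => //= _.
  case: (eqVneq (b _) _) => //= _.
have lo : (\rank F * g <= \sum_(r < \rank F) \sum_(i < #|E|) (F (f r) i != 0%R))%N.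
  rewrite -[X in (X * _)%N](card_ord (\rank F)) -sum_nat_const; apply: leq_sum => r _.
  by apply: leq_trans (big r) _; rewrite -sum1_card big_mkcond leq_sum //= => i _; rewrite inE; case: (_ != _).
have hi : (\sum_(r < \rank F) \sum_(i < #|E|) (F (f r) i != 0%R) <= #|E| * 2)%N.
  rewrite exchange_big /= -[X in (_ <= X * _)%N](card_ord #|E|) -sum_nat_const; apply: leq_sum => i _.
  apply: leq_trans (small i).
  by rewrite -[leqRHS]sum1_card [leqRHS]big_mkcond leq_sum //= => r _; rewrite inE; case: (_ != _).
nia.
Qed.

(** * Minors of the square grid *)

Lemma F2_double (x y : 'F_2) : y = x + x -> y = 0.
Proof. by move=> ->; exact: F2_addxx. Qed.

Definition grid_nbrs (u : nat * nat) : seq (nat * nat) :=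
  [:: (u.1.+1, u.2); (u.1, u.2.+1)]
  ++ (if u.1 is i.+1 then [:: (i, u.2)] else [::])
  ++ (if u.2 is j.+1 then [:: (u.1, j)] else [::]).

Arguments grid_nbrs : simpl never.

Definition grid_adj : rel (nat * nat) := fun u w => w \in grid_nbrs u.

Lemma grid_adjE u w : grid_adj u w =
  ((u.2 == w.2) && ((u.1 == w.1.+1) || (w.1 == u.1.+1)))
  || ((u.1 == w.1) && ((u.2 == w.2.+1) || (w.2 == u.2.+1))).
Proof.
case: u w => [i j] [i' j']; rewrite /grid_adj /grid_nbrs /=.
by case: i j => [|i] [|j]; rewrite /= !inE !xpair_eqE /=; lia.
Qed.

Lemma grid_adj_sym u w : grid_adj u w = grid_adj w u.
Proof. by rewrite !grid_adjE; lia. Qed.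

Lemma grid_adjxx u : grid_adj u u = false.
Proof. by rewrite grid_adjE; lia. Qed.

Lemma grid_nbrs_uniq u : uniq (grid_nbrs u).
Proof.
case: u => [[|i] [|j]] //=; rewrite ?inE /= !xpair_eqE; lia.
Qed.

(* [s i j] is the value of [s] on the unit square whose upper right corner is
   [(i, j)], so that every grid edge lies between two indexed squares; [jump s]
   compares the two squares on either side of the edge [u w]. *)
Definition jump (s : nat -> nat -> 'F_2) (u w : nat * nat) : 'F_2 :=
  let i := minn u.1 w.1 in let j := minn u.2 w.2 in
  s i.+1 j.+1 + (if u.2 == w.2 then s i.+1 j else s i j.+1).

Lemma jumpC s u w : jump s u w = jump s w u.
Proof. by rewrite /jump minnC [minn u.2 _]minnC eq_sym. Qed.

(** Each of the four squares around [u] lies beside two of the edges at [u], so its value cancels.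
    On the border the missing edge would separate two squares of index 0, where [s] is constant. *)
Lemma sum_jump_nbrs s u :
  (forall j, s 0%N j = s 0%N 0%N) -> (forall i, s i 0%N = s 0%N 0%N) ->
  \sum_(w <- grid_nbrs u) jump s u w = 0.
Proof.
move=> s0 s1.
have minSl k : minn k.+1 k = k by lia.
have minSr k : minn k k.+1 = k by lia.
have eS k : (k == k.+1) = false by lia.
have eS' k : (k.+1 == k) = false by lia.
case: u => [[|i] [|j]]; rewrite /grid_nbrs /= ?big_cons big_nil /jump /=
  ?minnn ?minSl ?minSr ?eqxx ?eS ?eS' ?s0 ?s1 ?addr0.
- exact: F2_addxx.
- by apply: (@F2_double (s 1%N j.+2 + s 1%N j.+1 + s 0%N 0%N)); ring.
- by apply: (@F2_double (s i.+2 1%N + s i.+1 1%N + s 0%N 0%N)); ring.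
by apply: (@F2_double (s i.+2 j.+2 + s i.+1 j.+2 + s i.+2 j.+1 + s i.+1 j.+1)); ring.
Qed.

(** The parity with which the ray going straight down from the square crosses [c]; it vanishes on
    the squares outside the quadrant. *)
Definition potential (c : nat * nat -> nat * nat -> 'F_2) (i j : nat) : 'F_2 :=
  if i is i'.+1 then \sum_(0 <= k < j) c (i', k) (i'.+1, k) else 0.

Arguments potential : simpl never.

Lemma F2_eqP (x y : 'F_2) : x + y = 0 -> x = y.
Proof. by move/eqP; rewrite addr_eq0 F2_oppE => /eqP. Qed.

(** Across a horizontal edge the two sums differ in one term. For vertical edges the claim climbs
    the column: the vanishing sum of [c] at a grid point carries it from the edge below to the edge
    above. *)
Lemma jump_potential (c : nat * nat -> nat * nat -> 'F_2) u w :
    (forall u w, c u w = c w u) -> (forall u, \sum_(w <- grid_nbrs u) c u w = 0) ->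
  grid_adj u w -> jump (potential c) u w = c u w.
Proof.
move=> cC ev.
(* Edges that would leave the quadrant get the value 0, so that [star] has four terms on the border
   as well. *)
pose hor i j : 'F_2 := if i is i'.+1 then c (i', j) (i, j) else 0.
pose ver i j : 'F_2 := if j is j'.+1 then c (i, j') (i, j) else 0.
have potS i j : potential c i j.+1 = potential c i j + hor i j.
  by case: i => [|i]; rewrite /potential /hor ?addr0 // big_nat_recr.
have pot0 i : potential c i 0 = 0 by case: i => [|i]; rewrite /potential ?big_geq.
have star i j : hor i.+1 j + ver i j.+1 + hor i j + ver i j = 0.
  rewrite -(ev (i, j)) /grid_nbrs /hor /ver.
  case: i j => [|i] [|j]; rewrite /= !big_cons big_nil !addr0 ?addrA //.
  - by rewrite (cC (0%N, j.+1) (0%N, j)).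
  - by rewrite (cC (i.+1, 0%N) (i, 0%N)).
  by rewrite (cC (i.+1, j.+1) (i, j.+1)) (cC (i.+1, j.+1) (i.+1, j)).
have horiz i j : jump (potential c) (i, j) (i.+1, j) = c (i, j) (i.+1, j).
  rewrite /jump /= minnn eqxx; have -> : minn i i.+1 = i by lia.
  by rewrite potS addrAC F2_addxx add0r.
have vert i j : jump (potential c) (i, j) (i, j.+1) = c (i, j) (i, j.+1).
  rewrite /jump /= minnn; have -> : minn j j.+1 = j by lia.
  have -> : (j == j.+1) = false by lia.
  rewrite -[RHS]/(ver i j.+1).
  elim: j => [|j IH]; apply: F2_eqP; rewrite !potS.
    by rewrite -[RHS](star i 0%N) !pot0 /=; ring.
  rewrite -[RHS](star i j.+1) -[ver i j.+1]IH !potS; ring.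
rewrite grid_adjE; case: u w => [i j] [i' j'] /= /orP[] /andP[/eqP->] /orP[] /eqP -> //.
  by rewrite jumpC cC.
by rewrite jumpC cC.
Qed.

Lemma big_uniq_delta (I : eqType) (s : seq I) (b : I) (F : I -> 'F_2) :
  uniq s -> \sum_(w <- s) (w == b)%:R * F w = (b \in s)%:R * F b.
Proof.
move=> us; case: (boolP (b \in s)) => bs; last first.
  rewrite mul0r big_seq big1 // => w ws; case: eqP => [wb|]; last by rewrite mul0r.
  by rewrite -wb ws in bs.
rewrite (bigD1_seq b) //= eqxx big1 ?addr0 // => w /negPf ->.
by rewrite mul0r.
Qed.

Lemma sum_sym_F2 (I : Type) (s : seq I) (f : I -> I -> 'F_2) :
  (forall a b, f a b = f b a) -> (forall a, f a a = 0) ->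
  \sum_(a <- s) \sum_(b <- s) f a b = 0.
Proof.
move=> fC f0; elim: s => [|x s IH]; first by rewrite big_nil.
rewrite !big_cons f0 add0r; under [X in _ + X]eq_bigr => a _ do rewrite big_cons fC.
by rewrite big_split /= IH addr0 F2_addxx.
Qed.

Lemma big_uniq_mem (I : eqType) (s t : seq I) (F : I -> 'F_2) :
    uniq s -> uniq t ->
  \sum_(b <- s | b \in t) F b = \sum_(b <- t) (b \in s)%:R * F b.
Proof.
move=> us ut; transitivity (\sum_(b <- t | b \in s) F b).
  rewrite -big_filter -[RHS]big_filter; apply: perm_big; apply: uniq_perm.
  - exact: filter_uniq.
  - exact: filter_uniq.
  by move=> b; rewrite !mem_filter andbC.
rewrite big_mkcond; apply: eq_bigr => b _.
by case: ifP; rewrite ?mul1r ?mul0r.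
Qed.

Definition edge_chain (a b u w : nat * nat) : 'F_2 :=
  (u == a)%:R * (w == b)%:R + (u == b)%:R * (w == a)%:R.

Lemma edge_chainC a b u w : edge_chain a b u w = edge_chain a b w u.
Proof. by rewrite /edge_chain addrC mulrC [X in _ + X]mulrC. Qed.

Lemma edge_chain_neq0 a b u w : edge_chain a b u w != 0 ->
  (u = a /\ w = b) \/ (u = b /\ w = a).
Proof.
rewrite /edge_chain -!natrM !mulnb.
case: (boolP ((u == a) && _)) => [/andP[/eqP-> /eqP->]|_]; first by left.
case: (boolP (_ && _)) => [/andP[/eqP-> /eqP->]|_]; first by right.
by rewrite addr0 eqxx.
Qed.

Lemma sum_edge_chain a b z : grid_adj a b ->
  \sum_(w <- grid_nbrs z) edge_chain a b z w = (z == a)%:R + (z == b)%:R.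
Proof.
move=> ab; rewrite big_split /= -!mulr_sumr.
have D b' : \sum_(w <- grid_nbrs z) (w == b')%:R = (grid_adj z b')%:R :> 'F_2.
  rewrite -[RHS]mulr1 -(big_uniq_delta b' (fun=> 1) (grid_nbrs_uniq z)).
  by apply: eq_bigr => w _; rewrite mulr1.
rewrite !D; congr (_ + _); first by case: eqP => [->|]; rewrite ?mul0r // ab mulr1.
by case: eqP => [->|]; rewrite ?mul0r // grid_adj_sym ab mulr1.
Qed.

Fixpoint walk_chain (u : nat * nat) (p : seq (nat * nat)) (z w : nat * nat) : 'F_2 :=
  if p is v :: p' then edge_chain u v z w + walk_chain v p' z w else 0.

Lemma walk_chainC u p z w : walk_chain u p z w = walk_chain u p w z.
Proof. by elim: p u => //= v p IH u; rewrite edge_chainC IH. Qed.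

Lemma sum_walk_chain u p z : path grid_adj u p ->
  \sum_(w <- grid_nbrs z) walk_chain u p z w = (z == u)%:R + (z == last u p)%:R.
Proof.
elim: p u => [|v p IH] u /=; first by rewrite big1 // F2_addxx.
move=> /andP[uv vp]; rewrite big_split /= sum_edge_chain // IH //.
by rewrite -addrA [X in _ + X]addrA F2_addxx add0r.
Qed.

Lemma walk_chain_support u p z w :
  walk_chain u p z w != 0 -> (z \in u :: p) && (w \in u :: p).
Proof.
elim: p u => [//|v p IH] u; rewrite [walk_chain _ _ _ _]/=.
have [->|] := eqVneq (edge_chain u v z w) 0.
  by rewrite add0r => /IH /andP[zp wp]; rewrite !(in_cons u) zp wp !orbT.
move/edge_chain_neq0 => [] [-> ->] _; by rewrite !inE !eqxx !orbT.
Qed.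

(** [U x] is the branch set of [x] in the quarter-plane grid, and [c x] is a base point from which
    it is reached without leaving it. An isolated vertex may have an empty branch set. *)
Definition grid_minor (T : finType) (e : rel T) : Prop :=
  exists (U : T -> seq (nat * nat)) (c : T -> nat * nat),
    [/\ forall x y u, u \in U x -> u \in U y -> x = y,
        forall x u, u \in U x -> exists p,
          [/\ path grid_adj (c x) p, last (c x) p = u & {subset c x :: p <= U x}]
      & forall x y, e x y ->
          exists u w, [/\ u \in U x, w \in U y & grid_adj u w]].

(** Ordering the ends by [enum_rank] makes every undirected edge a single element. *)
Definition edge (T : finType) (e : rel T) : predArgType :=
  {p : T * T | e p.1 p.2 && (enum_rank p.1 < enum_rank p.2)%N}.

Definition inc (T : finType) (e : rel T) (x : T) (i : edge e) :=
  (x == (val i).1) || (x == (val i).2).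

(** Cycles of the graph are lifted to the grid, where each is the boundary of its potential. Squares
    on which all these potentials agree form one face, and the faces meet the hypotheses of
    [face_count]. *)
Lemma grid_minor_count (T : finType) (e : rel T) (g : nat) :
    irreflexive e -> grid_minor e ->
    (forall C, even_chain (@inc T e) C -> (exists i, C i != 0) ->
       (g <= #|[pred i | C i != 0%R]|)%N) ->
  (g * #|edge e| <= g * #|T| + 2 * #|edge e|)%N.
Proof.
move=> irr [U0 [c [dis0 con0 adjU0]]] girth.
pose U x := undup (U0 x).
have dis x y u : u \in U x -> u \in U y -> x = y.
  by rewrite !mem_undup; exact: dis0.
have con x u : u \in U x -> exists p,
    [/\ path grid_adj (c x) p, last (c x) p = u & {subset c x :: p <= U x}].
  rewrite mem_undup => /con0[p [? ? sp]]; exists p; split=> // v /sp.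
  by rewrite mem_undup.
have {adjU0 con0 dis0} adjU x y : e x y ->
    exists u w, [/\ u \in U x, w \in U y & grid_adj u w].
  by move=> /adjU0[u [w [? ? ?]]]; exists u, w; rewrite !mem_undup.
(* The chain [d.2] runs from base point to base point inside the two branch sets; the crossing edge
   [d.1] is the only edge of it that leaves a branch set. *)
have chain (i : edge e) : exists d : (nat * nat) * (nat * nat) *
    (nat * nat -> nat * nat -> 'F_2),
  [/\ [/\ d.1.1 \in U (val i).1, d.1.2 \in U (val i).2 & grid_adj d.1.1 d.1.2],
      forall u w, d.2 u w = d.2 w u,
      forall z, \sum_(w <- grid_nbrs z) d.2 z w
        = (z == c (val i).1)%:R + (z == c (val i).2)%:R
    & forall x u w, u \in U x -> w \notin U x ->
        d.2 u w = edge_chain d.1.1 d.1.2 u w].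
  case: i => -[x y] /= /andP[/[dup] exy /adjU[u [w [ux wy uw]]] _].
  have [p [pp pl ps]] := con x u ux; have [q [qp ql qs]] := con y w wy.
  exists (u, w, fun a b => walk_chain (c x) p a b + edge_chain u w a b + walk_chain (c y) q a b).
  split=> //=.
  - by move=> a b; rewrite walk_chainC edge_chainC [walk_chain (c y) _ _ _]walk_chainC.
  - move=> z; rewrite big_split /= big_split /= !sum_walk_chain // sum_edge_chain // pl ql.
    apply: F2_eqP; apply: (@F2_double ((z == c x)%:R + (z == u)%:R + (z == w)%:R + (z == c y)%:R)).
    ring.
  move=> x' a b ax bx.
  have off y' r : {subset c y' :: r <= U y'} -> walk_chain (c y') r a b = 0.
    move=> sr; apply/eqP; apply: contraNT bx => /walk_chain_support/andP[/sr ay /sr b_y].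
    by rewrite (dis _ _ _ ax ay).
  by rewrite !off // add0r addr0.
have [d dP] := fin_all_exists chain.
pose u i := (d i).1.1; pose w i := (d i).1.2; pose cc i := (d i).2.
have uU i : u i \in U (val i).1 by case: (dP i) => -[].
have wU i : w i \in U (val i).2 by case: (dP i) => -[].
have uw i : grid_adj (u i) (w i) by case: (dP i) => -[].
have ccC i a b : cc i a b = cc i b a by have [_ H _ _] := dP i; exact: H.
have ccS i z : \sum_(b <- grid_nbrs z) cc i z b
    = (z == c (val i).1)%:R + (z == c (val i).2)%:R by have [_ _ H _] := dP i; exact: H.
have ccE i x a b : a \in U x -> b \notin U x -> cc i a b = edge_chain (u i) (w i) a b.
  by case: (dP i) => _ _ _ H; exact: H.
have ne12 (i : edge e) : (val i).1 != (val i).2.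
  by case: i => -[x y] /= /andP[exy _]; apply: contraTneq exy => ->; rewrite irr.
have wNU i : w i \notin U (val i).1.
  by apply: contraNN (ne12 i) => wi; rewrite (dis _ _ _ wi (wU i)).
have stepinj i j : edge_chain (u j) (w j) (u i) (w i) = (j == i)%:R.
  case: (eqVneq j i) => [->|ji].
    have /negPf nuw : u i != w i by apply: contraNneq (wNU i) => <-.
    by rewrite /edge_chain !eqxx nuw [w i == u i]eq_sym nuw mulr0 addr0 mulr1.
  apply/eqP; apply: contraNT ji => /edge_chain_neq0[] [E1 E2].
    apply/eqP/val_inj; rewrite [LHS]surjective_pairing [RHS]surjective_pairing.
    have uU' := uU i; have wU' := wU i; rewrite E1 in uU'; rewrite E2 in wU'.
    by rewrite (dis _ _ _ uU' (uU j)) (dis _ _ _ wU' (wU j)).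
  have uU' := uU i; have wU' := wU i; rewrite E1 in uU'; rewrite E2 in wU'.
  have h1 := dis _ _ _ uU' (wU j); have h2 := dis _ _ _ wU' (uU j).
  have /andP[_] := valP i; have /andP[_] := valP j; rewrite h1 h2.
  by move=> h; rewrite ltnNge ltnW.
(* The boundary of the lift at [z] collects the boundary of [C] at the vertices with base point [z],
   so cycles lift to cycles. *)
pose lft (C : edge e -> 'F_2) a b : 'F_2 := \sum_i C i * cc i a b.
have lftC C a b : lft C a b = lft C b a by apply: eq_bigr => i _; rewrite ccC.
have lftS C : even_chain (@inc T e) C -> forall z, \sum_(b <- grid_nbrs z) lft C z b = 0.
  move=> /forallP ev z; rewrite exchange_big /=.
  under eq_bigr => i _ do rewrite -mulr_sumr ccS.
  transitivity (\sum_(x : T) (z == c x)%:R * \sum_(i | inc x i) C i); last first.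
    by rewrite big1 // => x _; rewrite (eqP (ev x)) mulr0.
  under [RHS]eq_bigr => x _ do rewrite big_mkcond mulr_sumr.
  rewrite [RHS]exchange_big /=; apply: eq_bigr => i _.
  rewrite (bigD1 (val i).1) //= (bigD1 (val i).2) /=; last by rewrite eq_sym ne12.
  rewrite big1 ?addr0 => [|x /andP[x1 x2]]; last by rewrite /inc (negPf x1) (negPf x2) mulr0.
  by rewrite /inc !eqxx orbT /= mulrDr !(mulrC (C i)).
(* The face of a square is the table of its potentials for all lifted cycles, with default 0 on
   chains that are not cycles. Such tables form a finite type, and evaluating them at [C] gives the
   function [S] for [C]. *)
pose key (i j : nat) : {ffun {ffun edge e -> 'F_2} -> 'F_2} :=
  [ffun C : {ffun edge e -> 'F_2} =>
     if even_chain (@inc T e) C then potential (lft C) i j else 0].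
pose sqA (a b : nat * nat) := key (minn a.1 b.1).+1 (minn a.2 b.2).+1.
pose sqB (a b : nat * nat) := if a.2 == b.2 then key (minn a.1 b.1).+1 (minn a.2 b.2)
  else key (minn a.1 b.1) (minn a.2 b.2).+1.
have key0 j : key 0%N j = key 0%N 0%N by apply/ffunP => C; rewrite !ffunE.
have key1 i : key i 0%N = key 0%N 0%N.
  apply/ffunP => C; rewrite !ffunE; case: ifP => // _.
  by case: i => [|i]; rewrite /potential ?big_geq.
apply: (@face_count T _ _ (@inc T e) (fun i => sqA (u i) (w i)) (fun i => sqB (u i) (w i))) => //.
  move=> C0 evC0; pose C := [ffun i => C0 i].
  have evC : even_chain (@inc T e) C.
    apply/forallP => x; apply/eqP; rewrite -[RHS](eqP (forallP evC0 x)).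
    by apply: eq_bigr => i _; rewrite ffunE.
  exists (fun q : {ffun {ffun edge e -> 'F_2} -> 'F_2} => q C) => i.
  transitivity (jump (potential (lft C)) (u i) (w i)).
    rewrite jump_potential //; last exact: lftS.
    rewrite /lft (bigD1 i) //= (ccE i _ _ _ (uU i) (wNU i)) stepinj eqxx mulr1 ffunE.
    rewrite big1 ?addr0 // => j ji.
    by rewrite (ccE j _ _ _ (uU i) (wNU i)) stepinj (negPf ji) mulr0.
  by rewrite /jump /sqA /sqB; case: ifP => _; rewrite !ffunE evC.
move=> q; apply/forallP => x; apply/eqP.
(* The jumps of this indicator are the boundary of the face [q]. They sum to 0 at each grid point,
   and edges inside [U x] count twice, so the jumps along the edges leaving [U x] sum to 0. *)
pose s i j : 'F_2 := (key i j == q)%:R.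
have s0 z : \sum_(b <- grid_nbrs z) jump s z b = 0.
  by apply: sum_jump_nbrs => k; rewrite /s ?key0 ?key1.
have sE i : (sqA (u i) (w i) == q)%:R + (sqB (u i) (w i) == q)%:R = jump s (u i) (w i).
  by rewrite /jump /sqA /sqB; case: ifP.
under eq_bigr => i _ do rewrite sE.
have uUx : uniq (U x) by exact: undup_uniq.
have inner : \sum_(a <- U x) \sum_(b <- U x) (b \in grid_nbrs a)%:R * jump s a b = 0.
  apply: sum_sym_F2 => [a b|a]; first by rewrite jumpC -![_ \in grid_nbrs _]/(grid_adj _ _) grid_adj_sym.
  by rewrite -[_ \in grid_nbrs _]/(grid_adj a a) grid_adjxx mul0r.
have total : \sum_(a <- U x) \sum_(b <- grid_nbrs a | b \notin U x) jump s a b = 0.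
  rewrite -[RHS]inner; apply: F2_eqP; rewrite -big_split big1 //= => a _.
  rewrite -(big_uniq_mem _ (grid_nbrs_uniq a) uUx) addrC -[RHS](s0 a).
  by rewrite [RHS](bigID (fun b => b \in U x)).
rewrite -[RHS]total.
(* If [s] jumps across an edge leaving [U x], the two keys differ, so some lifted cycle uses this
   edge; it is then the crossing edge of exactly one graph edge, and that one is incident with
   [x]. *)
have leave a b : a \in U x -> b \in grid_nbrs a -> b \notin U x ->
    jump s a b = \sum_(i | inc x i) edge_chain (u i) (w i) a b * jump s (u i) (w i).
  move=> aU ab bU.
  transitivity ((\sum_(i | inc x i) edge_chain (u i) (w i) a b) * jump s a b); last first.
    rewrite mulr_suml; apply: eq_bigr => i _.
    have [->|/edge_chain_neq0[] [-> ->] //] := eqVneq (edge_chain (u i) (w i) a b) 0.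
      by rewrite !mul0r.
    by rewrite [jump s (w i) _]jumpC.
  have [->|nz] := eqVneq (jump s a b) 0; first by rewrite mulr0.
  have sqAB : sqA a b != sqB a b.
    apply: contraNneq nz => AB.
    have -> : jump s a b = (sqA a b == q)%:R + (sqB a b == q)%:R.
      by rewrite /jump /sqA /sqB; case: ifP.
    by rewrite AB F2_addxx.
  have [C CAB] : exists C, sqA a b C != sqB a b C.
    apply/existsP; apply: contraNT sqAB; rewrite negb_exists => /forallP h.
    by apply/eqP/ffunP => C; apply/eqP/negbNE.
  have [i nzi] : exists i, cc i a b != 0.
    have evC : even_chain (@inc T e) C.
      apply: contraNT CAB => nev; rewrite /sqA /sqB.
      by case: ifP => _; rewrite !ffunE (negPf nev).
    have : lft C a b != 0.
      rewrite -(jump_potential (lftC C) (lftS C evC) ab).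
      apply: contraNneq CAB => /F2_eqP; rewrite /sqA /sqB.
      by case: ifP => _ E; rewrite !ffunE evC E.
    move=> nzl; apply/existsP; apply: contraNT nzl; rewrite negb_exists => /forallP h.
    by rewrite /lft big1 // => i _; rewrite (eqP (negbNE (h i))) mulr0.
  rewrite (ccE i x) // in nzi.
  have estepD j : edge_chain (u j) (w j) a b = (j == i)%:R.
    by case/edge_chain_neq0: nzi => [] [-> ->]; [|rewrite edge_chainC]; rewrite stepinj.
  have ix : inc x i.
    rewrite /inc; case/edge_chain_neq0: nzi => [] [aE _]; rewrite aE in aU.
      by rewrite (dis _ _ _ aU (uU i)) eqxx.
    by rewrite (dis _ _ _ aU (wU i)) eqxx orbT.
  rewrite (bigD1 i) //= estepD eqxx big1 ?addr0 ?mul1r // => j /andP[_ /negPf ji].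
  by rewrite estepD ji.
(* Only one direction of the crossing edge starts in [U x], so it is counted once and does not
   cancel. *)
have cross i : inc x i ->
    \sum_(a <- U x) \sum_(b <- grid_nbrs a | b \notin U x) edge_chain (u i) (w i) a b = 1.
  have one p r : p \in U x -> r \notin U x -> grid_adj p r ->
      \sum_(a <- U x) \sum_(b <- grid_nbrs a | b \notin U x) (a == p)%:R * (b == r)%:R = 1 :> 'F_2.
    move=> pU rU pr; under eq_bigr => a _ do rewrite -mulr_sumr.
    rewrite (big_uniq_delta p (fun a => \sum_(b <- grid_nbrs a | b \notin U x) (b == r)%:R)) //.
    rewrite pU mul1r -big_filter.
    transitivity (\sum_(b <- [seq b <- grid_nbrs p | b \notin U x]) (b == r)%:R * 1 : 'F_2).
      by apply: eq_bigr => b _; rewrite mulr1.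
    rewrite (big_uniq_delta r (fun=> 1)) ?filter_uniq ?grid_nbrs_uniq //.
    by rewrite mem_filter rU -[_ \in grid_nbrs p]/(grid_adj p r) pr mulr1.
  case/orP=> /eqP xE; subst x.
    rewrite -[RHS](one _ _ (uU i) (wNU i) (uw i)) big_seq [RHS]big_seq.
    apply: eq_bigr => a aU; apply: eq_bigr => b bU.
    rewrite /edge_chain; case: (eqVneq a (w i)) => [aw|_]; last by rewrite mul0r addr0.
    by rewrite aw (negPf (wNU i)) in aU.
  have uNU : u i \notin U (val i).2.
    by apply: contraNN (ne12 i) => ui; rewrite (dis _ _ _ ui (uU i)).
  have wu : grid_adj (w i) (u i) by rewrite grid_adj_sym.
  rewrite -[RHS](one _ _ (wU i) uNU wu) big_seq [RHS]big_seq.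
  apply: eq_bigr => a aU; apply: eq_bigr => b bU.
  rewrite /edge_chain; case: (eqVneq a (u i)) => [au|_]; last by rewrite mul0r add0r.
  by rewrite au (negPf uNU) in aU.
transitivity (\sum_(a <- U x) \sum_(b <- grid_nbrs a | b \notin U x)
   \sum_(i | inc x i) edge_chain (u i) (w i) a b * jump s (u i) (w i)); last first.
  rewrite big_seq [RHS]big_seq; apply: eq_bigr => a aU.
  rewrite big_seq_cond [RHS]big_seq_cond; apply: eq_bigr => b /andP[ba bU].
  by rewrite (leave a b).
under [RHS]eq_bigr => a _ do rewrite exchange_big /=.
rewrite exchange_big /=; apply: eq_bigr => i ix.
under [RHS]eq_bigr => a _ do rewrite -mulr_suml.
by rewrite -mulr_suml cross // mul1r.
Qed.

Lemma edge_ends (T : finType) (e : rel T) (x : T) (i : edge e) :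
  simple_graph e -> inc x i ->
  exists y, [/\ e x y, x != y & forall z, inc z i = (z == x) || (z == y)].
Proof.
case=> sym irr; rewrite /inc; have /andP[ei _] := valP i.
have ne : (val i).1 != (val i).2.
  by apply: contraTneq ei => ->; rewrite irr.
case/orP => /eqP ->; first by exists (val i).2; split.
by exists (val i).1; rewrite sym eq_sym; split=> // z; rewrite orbC.
Qed.

Lemma edge_inj (T : finType) (e : rel T) (i j : edge e) :
  irreflexive e -> (forall z, inc z i = inc z j) -> i = j.
Proof.
move=> irr; case: i => -[p q] P; case: j => -[p' q'] P'; rewrite /inc /= => h.
have /andP[/= epq pq] := P; have /andP[/= _ pq'] := P'.
have npq : p != q by apply: contraTneq epq => ->; rewrite irr.
apply: val_inj => /=; move: (h p) (h q); rewrite !eqxx orbT /=.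
move=> /esym/orP[] /eqP pE /esym/orP[] /eqP qE; subst => //.
- by rewrite eqxx in npq.
- by have := ltn_trans pq pq'; rewrite ltnn.
by rewrite eqxx in npq.
Qed.

Lemma sum_deg_edges (T : finType) (e : rel T) :
  simple_graph e -> (\sum_x #|e x| <= 2 * #|edge e|)%N.
Proof.
case=> sym irr.
pose other x (i : edge e) := if (val i).1 == x then (val i).2 else (val i).1.
have le x : (#|e x| <= \sum_(i : edge e) inc x i)%N.
  have -> : (\sum_(i : edge e) inc x i)%N = #|[set i : edge e | inc x i]|.
    by rewrite -[RHS]sum1_card [RHS]big_mkcond /=; apply: eq_bigr => i _; rewrite inE; case: (inc _ _).
  apply: leq_trans (leq_imset_card (other x) _).
  apply/subset_leq_card/subsetP => y exy; apply/imsetP.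
  have exy' : e x y by [].
  have nr : enum_rank x != enum_rank y.
    by apply: contraTneq exy' => /enum_rank_inj ->; rewrite irr.
  have [lt|ge] := ltnP (enum_rank x) (enum_rank y).
    have P : e (x, y).1 (x, y).2 && (enum_rank (x, y).1 < enum_rank (x, y).2)%N by rewrite /= exy'.
    by exists (Sub (x, y) P); rewrite ?inE /inc /other /= eqxx.
  have P : e (y, x).1 (y, x).2 && (enum_rank (y, x).1 < enum_rank (y, x).2)%N.
    by rewrite /= sym exy' ltn_neqAle ge andbT eq_sym.
  exists (Sub (y, x) P); rewrite ?inE /inc /other /= ?eqxx ?orbT //.
  by case: eqP => // yx; rewrite yx eqxx in nr.
apply: (@leq_trans (\sum_(x : T) \sum_(i : edge e) inc x i)%N).
  by apply: leq_sum => x _; exact: le.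
rewrite exchange_big /= mulnC -sum_nat_const; apply: leq_sum => i _.
apply: leq_trans (_ : #|[set (val i).1; (val i).2]| <= 2)%N; last first.
  by rewrite cards2; case: (_ != _).
by rewrite -[leqRHS]sum1_card [leqRHS]big_mkcond; apply: leq_sum => x _; rewrite !inE /inc; case: (_ || _).
Qed.

(** An edge of the support can be continued at either end by another one. This gives edges [k], [i],
    [j], [l] along [c], [a], [u], [b], [d]; without triangles and 4-cycles [c] differs from [u], [b]
    and [d], so the continuation [m] at [c] is a fifth edge. *)
Lemma even_chain_supp (T : finType) (e : rel T) (C : edge e -> 'F_2) :
  simple_graph e -> girth_ge e 5 -> even_chain (@inc T e) C ->
  (exists i, C i != 0) -> (5 <= #|[pred i | C i != 0%R]|)%N.
Proof.
move=> simp girth /forallP ev [i Ci]; have [sym irr] := simp.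
have no3 x y z : e x y -> e y z -> e z x -> False.
  move=> xy yz zx; have := girth [:: x; y; z]; rewrite /= xy yz zx !inE /=.
  have /negPf-> : x != y by apply: contraTneq xy => ->; rewrite irr.
  have /negPf-> : y != z by apply: contraTneq yz => ->; rewrite irr.
  have /negPf-> : x != z by apply: contraTneq zx => ->; rewrite irr.
  by move=> /(_ isT isT isT).
have no4 x y z t : x != z -> y != t -> e x y -> e y z -> e z t -> e t x -> False.
  move=> /negPf xz /negPf yt xy yz zt tx; have := girth [:: x; y; z; t].
  rewrite /= xy yz zt tx !inE xz yt /=.
  have /negPf-> : x != y by apply: contraTneq xy => ->; rewrite irr.
  have /negPf-> : y != z by apply: contraTneq yz => ->; rewrite irr.
  have /negPf-> : z != t by apply: contraTneq zt => ->; rewrite irr.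
  have /negPf-> : x != t by apply: contraTneq tx => ->; rewrite irr.
  by move=> /(_ isT isT isT).
have next x j : inc x j -> C j != 0 -> exists2 k, k != j & inc x k && (C k != 0).
  move=> xj Cj; have /eqP := ev x; rewrite (bigD1 j) //= => s0.
  have : \sum_(k | inc x k && (k != j)) C k != 0.
    by apply: contraNneq Cj => E; rewrite E addr0 in s0; rewrite s0.
  move=> nz; have /existsP[k /and3P[]] : [exists k, [&& inc x k, k != j & C k != 0]].
    apply: contraNT nz; rewrite negb_exists => /forallP h.
    rewrite big1 // => k /andP[xk kj]; have := h k; rewrite xk kj /= negbK.
    by move/eqP.
  by move=> xk kj Ck; exists k; rewrite // xk.
have [u iu] : exists u, inc u i by exists (val i).1; rewrite /inc eqxx.
have [a [ua nua iE]] := edge_ends simp iu.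
have [j ji /andP[ju Cj]] := next u i iu Ci.
have [b [ub nub jE]] := edge_ends simp ju.
have ia : inc a i by rewrite iE eqxx orbT.
have jb : inc b j by rewrite jE eqxx orbT.
have [k ki /andP[ka Ck]] := next a i ia Ci.
have [c [ac nac kE]] := edge_ends simp ka.
have kc : inc c k by rewrite kE eqxx orbT.
have [l lj /andP[lb Cl]] := next b j jb Cj.
have [d [bd nbd lE]] := edge_ends simp lb.
have [m mk /andP[mc Cm]] := next c k kc Ck.
have nab : a != b.
  by apply: contraNneq ji => ab; apply/eqP/(edge_inj irr) => z; rewrite iE jE ab.
have ncu : c != u.
  apply: contraNneq ki => cu; apply/eqP/(edge_inj irr) => z.
  by rewrite iE kE cu orbC.
have ndu : d != u.
  apply: contraNneq lj => du; apply/eqP/(edge_inj irr) => z.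
  by rewrite jE lE du orbC.
have ncb : c != b.
  by apply/eqP => cb; apply: (@no3 u a c); rewrite // cb sym.
have ncd : c != d.
  by apply/eqP => cd; apply: (@no4 u a c b); rewrite // 1?eq_sym // ?cd sym.
have diff z (i1 i2 : edge e) : inc z i1 -> ~~ inc z i2 -> i1 != i2.
  by move=> h1; apply: contraNneq => <-.
have li : l != i.
  by apply: (diff b) => //; rewrite iE negb_or !(eq_sym b) nub.
have kj : k != j.
  by apply: (diff a) => //; rewrite jE negb_or !(eq_sym a) nua eq_sym.
have lk : l != k.
  by apply: (diff b) => //; rewrite kE negb_or ![b == _]eq_sym nab.
have mi : m != i.
  by apply: (diff c) => //; rewrite iE negb_or ncu eq_sym.
have mj : m != j.
  by apply: (diff c) => //; rewrite jE negb_or ncu.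
have ml : m != l.
  by apply: (diff c) => //; rewrite lE negb_or ncb.
have us : uniq [:: m; l; k; j; i].
  by rewrite /= !inE !negb_or ml mk mj mi lj ki ji lk li kj.
rewrite -[5%N]/(size [:: m; l; k; j; i]) -(card_uniqP us); apply/subset_leq_card/subsetP => z.
by rewrite !inE => /or4P[/eqP->|/eqP->|/eqP->|/orP[]/eqP->].
Qed.

Lemma grid_minor_sum_deg (T : finType) (e : rel T) :
  simple_graph e -> girth_ge e 5 -> grid_minor e ->
  (3 * \sum_x #|e x| <= 10 * #|T|)%N.
Proof.
move=> simp girth gm; have le := sum_deg_edges simp.
have := grid_minor_count (proj2 simp) gm (fun C => even_chain_supp simp girth).
lia.
Qed.

Lemma path_to (T : eqType) (r : rel T) x p u : path r x p -> u \in x :: p ->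
  exists q, [/\ path r x q, last x q = u & {subset x :: q <= x :: p}].
Proof.
move=> rp up; case/splitPl: up rp => p1 p2 l; rewrite cat_path => /andP[rp1 _].
exists p1; split=> // v; rewrite !inE mem_cat => /orP[->//|->].
by rewrite orbT.
Qed.

(** The walks [A x y] form a star around [c x], and [K x y] connects the stars of [x] and [y]. A
    connecting walk may run into the stars of both its ends and into connecting walks with the same
    lower end; cutting it at the star of [y] makes the branch sets disjoint. *)
Lemma walks_grid_minor (T : finType) (e : rel T) (c : T -> nat * nat)
    (d : T -> T -> nat * nat) (A K : T -> T -> seq (nat * nat)) :
    simple_graph e ->
    let lt x y := (enum_rank x < enum_rank y)%N in
    (forall x y, e x y -> path grid_adj (c x) (A x y) /\ last (c x) (A x y) = d x y) ->
    (forall x y, e x y -> lt x y ->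
       path grid_adj (d x y) (K x y) /\ last (d x y) (K x y) = d y x) ->
    (forall x y x' y' u, e x y -> e x' y' ->
       u \in c x :: A x y -> u \in c x' :: A x' y' -> x = x') ->
    (forall x y z w u, e x y -> lt x y -> e z w ->
       u \in d x y :: K x y -> u \in c z :: A z w -> z = x \/ z = y) ->
    (forall x y x' y' u, e x y -> lt x y -> e x' y' -> lt x' y' ->
       u \in d x y :: K x y -> u \in d x' y' :: K x' y' -> x = x') ->
  grid_minor e.
Proof.
move=> [sym irr] lt Awalk Kwalk AA KA KK.
pose B z := flatten [seq c z :: A z w | w <- enum T & e z w].
have BP z u : reflect (exists2 w, e z w & u \in c z :: A z w) (u \in B z).
  apply: (iffP flatten_mapP) => [[w]|[w zw uw]].
    by rewrite mem_filter => /andP[zw _] uw; exists w.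
  by exists w; rewrite // mem_filter zw mem_enum.
(* The connecting walk up to its first visit to [B y] is given to [x]. *)
pose pre x y := take (find [in B y] (K x y)) (K x y).
have preK x y u : u \in pre x y -> u \in K x y by exact: mem_take.
have preB x y u : u \in pre x y -> u \notin B y.
  case/(nthP (0, 0)%N) => i; rewrite size_take_min leq_min => /andP[ilt _].
  by rewrite nth_take // => <-; apply/negbT/(before_find (0, 0)%N).
pose C x := flatten [seq pre x y | y <- enum T & e x y && lt x y].
have CP x u : reflect (exists y, [/\ e x y, lt x y & u \in pre x y]) (u \in C x).
  apply: (iffP flatten_mapP) => [[y]|[y [xy lxy uy]]].
    by rewrite mem_filter => /andP[/andP[xy l] _] uw; exists y.
  by exists y; rewrite // mem_filter xy lxy mem_enum.
have BC x y u : u \in B x -> u \in C y -> x = y.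
  move=> /BP[w xw uw] /CP[z [yz lyz uz]].
  have uK : u \in d y z :: K y z by rewrite inE (preK _ _ _ uz) orbT.
  have [//|xz] := KA _ _ _ _ _ yz lyz xw uK uw.
  have /negP[] := preB _ _ _ uz; apply/BP; rewrite -xz; by exists w.
exists (fun x => B x ++ C x), c; split.
- move=> x y u; rewrite !mem_cat => /orP[uBx|uCx] /orP[uBy|uCy].
  + by have [/BP[w xw uw] /BP[w' yw' uw']] := (uBx, uBy); exact: AA uw uw'.
  + exact: BC uBx uCy.
  + by rewrite (BC _ _ _ uBy uCx).
  have [/CP[z [xz lxz uz]] /CP[z' [yz' lyz' uz']]] := (uCx, uCy).
  by apply: (KK x z y z' u) => //; rewrite inE (preK _ _ _ uz, preK _ _ _ uz') orbT.
- move=> x u; rewrite mem_cat => /orP[/BP[w xw uw]|/CP[y [xy lxy uy]]].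
    have [pA _] := Awalk x w xw; have [q [pq lq sq]] := path_to pA uw.
    exists q; split=> // v /sq vA; rewrite mem_cat; apply/orP; left.
    by apply/BP; exists w.
  have [pA lA] := Awalk x y xy; have [pK _] := Kwalk x y xy lxy.
  have pP : path grid_adj (d x y) (pre x y) by exact: take_path.
  have [|q [pq lq sq]] := path_to pP (u := u); first by rewrite inE uy orbT.
  exists (A x y ++ q); split; rewrite ?cat_path ?pA ?last_cat ?lA //.
  move=> v; rewrite -cat_cons mem_cat => /orP[vA|vq].
    by rewrite mem_cat; apply/orP; left; apply/BP; exists y.
  have := sq v; rewrite !inE vq orbT => /(_ isT) /orP[/eqP ->|vp].
    rewrite mem_cat; apply/orP; left; apply/BP; exists y => //.
    by rewrite -lA mem_last.
  by rewrite mem_cat; apply/orP; right; apply/CP; exists y.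
have lastB x y : e x y -> d x y \in B x.
  by move=> xy; apply/BP; exists y => //; have [_ <-] := Awalk x y xy; exact: mem_last.
have main x y : e x y -> lt x y -> exists u w,
    [/\ u \in B x ++ C x, w \in B y ++ C y & grid_adj u w].
  move=> xy lxy; have yx : e y x by rewrite sym.
  have [pK lK] := Kwalk x y xy lxy.
  (* The list [K x y] omits its starting point [d x y]; were it empty, [d x y] would equal [d y x]
     and lie in the stars of both ends. *)
  have hK : has [in B y] (K x y).
    apply/hasP; exists (d y x); last exact: lastB.
    have := mem_last (d x y) (K x y); rewrite lK inE => /orP[/eqP E|//].
    have := lastB _ _ xy; rewrite -E => /BP[w xw uw].
    have /BP[w' yw' uw'] := lastB _ _ yx.
    have xyE : x = y := AA _ _ _ _ _ xw yw' uw uw'.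
    by move: xy; rewrite xyE irr.
  pose k := find [in B y] (K x y).
  have kK : (k < size (K x y))%N by rewrite -has_find.
  exists (last (d x y) (pre x y)), (nth (d x y) (K x y) k); split.
  - have := mem_last (d x y) (pre x y); rewrite inE mem_cat => /orP[/eqP ->|lp].
      by rewrite lastB.
    by apply/orP; right; apply/CP; exists y.
  - by rewrite mem_cat; apply/orP; left; exact: (nth_find _ hK).
  move: pK; rewrite -{1}(cat_take_drop k (K x y)) cat_path => /andP[_].
  by rewrite (drop_nth (d x y) kK) /= => /andP[].
move=> x y xy; have [l|] := ltnP (enum_rank x) (enum_rank y); first exact: main.
rewrite leq_eqVlt => /orP[/eqP/val_inj/enum_rank_inj E|l].
  by rewrite E irr in xy.
have [|u [w [uU wU uw]]] := main y x _ l; first by rewrite sym.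
by exists w, u; rewrite grid_adj_sym.
Qed.

(** * From drawings to grid minors *)

From mathcomp Require Import all_classical all_reals.
From mathcomp Require Import topology normedtype.
From mathcomp Require Import Rstruct Rstruct_topology.
From mathcomp Require Import lra.

Import Order.TTheory Num.Theory.
Import numFieldNormedType.Exports.
Local Open Scope classical_set_scope.

Definition sup_close (R : realType) (d : R) (p q : R * R) : bool :=
  (`|p.1 - q.1| < d) && (`|p.2 - q.2| < d).

Definition cont01 (R : realType) (f : R -> R * R) : Prop :=
  forall s : R, 0 <= s <= 1 -> forall d, 0 < d ->
  exists2 r, 0 < r & forall t, 0 <= t <= 1 -> `|s - t| < r -> sup_close d (f s) (f t).

Lemma sup_closeC (R : realType) (d : R) p q : sup_close d p q = sup_close d q p.
Proof. by rewrite /sup_close distrC [`|p.2 - _|]distrC. Qed.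

Lemma sup_close_trans (R : realType) (d d' : R) p q r :
  sup_close d p q -> sup_close d' q r -> sup_close (d + d') p r.
Proof.
move=> /andP[a b] /andP[a' b']; apply/andP; split.
  by apply: le_lt_trans (ler_distD q.1 _ _) _; rewrite ltrD.
by apply: le_lt_trans (ler_distD q.2 _ _) _; rewrite ltrD.
Qed.

Lemma sup_close_le (R : realType) (d d' : R) p q : d <= d' -> sup_close d p q -> sup_close d' p q.
Proof. by move=> dd /andP[a b]; rewrite /sup_close !(lt_le_trans _ dd). Qed.

Lemma cont01_within (R : realType) (f : R -> R * R) :
  {within `[0%R, 1%R], continuous f} -> cont01 f.
Proof.
move=> /subspace_continuousP cf s s01 d d0.
have sI : [set` `[0%R, 1%R]%R] s by rewrite /= in_itv.
have := cf s sI; move=> /cvg_ballP /(_ d d0).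
rewrite near_withinE => -[r /= r0 H]; exists r => // t t01 st.
have tI : [set` `[0%R, 1%R]%R] t by rewrite /= in_itv.
by have [] := H t st tI; rewrite /sup_close => h1 h2; apply/andP; split.
Qed.

(** Compactness of the interval, with the filter at infinity in place of finite subcovers:
    monotonicity in [n] merges the local bounds. Uniform continuity, boundedness and separation are
    all instances. *)
Lemma compact01_unif (R : realType) (G : R -> nat -> Prop) :
    (forall t n m, (n <= m)%N -> G t n -> G t m) ->
    (forall s, 0 <= s <= 1 -> exists n, exists2 r, 0 < r &
       forall t, 0 <= t <= 1 -> `|s - t| < r -> G t n) ->
  exists n, forall t, 0 <= t <= 1 -> G t n.
Proof.
move=> mono loc.
have /compact_near_coveringP cc := @segment_compact R 0 1.
have := cc nat \oo (fun n t => 0 <= t <= 1 -> G t n) _.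
have FF : Filter \oo by exact: _.
move=> /(_ FF) [|n _ nP]; last first.
  by exists n => t t01; apply: (nP n) => //=; rewrite in_itv.
move=> s; rewrite /= in_itv /= => /loc [n [r r0 H]].
exists (ball s r, [set m | (n <= m)%N]).
  split => /=; first exact: nbhsx_ballx.
  by exists n.
by move=> [t m] /= [st nm] t01; apply: mono nm _; apply: H.
Qed.

Lemma exists_inv_lt (R : realType) (d : R) : 0 < d -> exists n, n.+1%:R^-1 < d.
Proof.
move=> d0; exists (Num.truncn d^-1); rewrite invf_plt ?posrE //.
by have /andP[] := truncn_itv (ltW (eqbRL (invr_gt0 d) d0)).
Qed.

Lemma inv_succ_le (R : realType) (n m : nat) : (n <= m)%N -> m.+1%:R^-1 <= n.+1%:R^-1 :> R.
Proof. by move=> nm; rewrite lef_pV2 ?posrE ?ltr0Sn // ler_nat. Qed.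

Lemma curve_unif (R : realType) (f : R -> R * R) (d : R) : cont01 f -> 0 < d ->
  exists n, forall s t, 0 <= s <= 1 -> 0 <= t <= 1 -> `|s - t| < n.+1%:R^-1 ->
    sup_close d (f s) (f t).
Proof.
move=> cf d0.
have [|s s01|n H] := @compact01_unif R (fun s n => forall t, 0 <= t <= 1 ->
  `|s - t| < n.+1%:R^-1 -> sup_close d (f s) (f t)).
- move=> t n m nm H t' t01 tt'; apply: H => //.
  by apply: lt_le_trans tt' _; exact: inv_succ_le.
- have d20 : 0 < d / 2 by lra.
  have [r r0 H] := cf s s01 _ d20.
  have r20 : 0 < r / 2 by lra.
  have [n nr] := exists_inv_lt r20; exists n, (r / 2) => // t t01 st t' t'01 tt'.
  rewrite [d]splitr; apply: (@sup_close_trans _ _ _ _ (f s)).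
    by rewrite sup_closeC; apply: H => //; lra.
  apply: H => //; apply: le_lt_trans (ler_distD t _ _) _.
  by rewrite [r]splitr ltrD // (lt_trans tt').
by exists n => s t s01 t01; apply: H.
Qed.

Lemma curve_bounded (R : realType) (f : R -> R * R) : cont01 f ->
  exists n : nat, forall s, 0 <= s <= 1 -> sup_close n%:R (f s) 0.
Proof.
move=> cf; apply: compact01_unif.
  by move=> t n m nm; apply: sup_close_le; rewrite ler_nat.
move=> s s01; have [r r0 H] := cf s s01 1 ltr01.
pose N := (Num.truncn (`|(f s).1| + `|(f s).2|)).+1.
have N1 : sup_close N%:R (f s) 0.
  have /andP[_ lt] := truncn_itv (addr_ge0 (normr_ge0 (f s).1) (normr_ge0 (f s).2)).
  rewrite /sup_close !subr0; apply/andP; split; apply: le_lt_trans lt.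
    by rewrite lerDl.
  by rewrite lerDr.
exists N.+1, r => // t t01 st; rewrite -addn1 natrD addrC.
by apply: sup_close_trans N1; rewrite sup_closeC; exact: H.
Qed.

Lemma curves_apart (R : realType) (f g : R -> R * R) : cont01 f -> cont01 g ->
    (forall s t, 0 <= s <= 1 -> 0 <= t <= 1 -> f s <> g t) ->
  exists n, forall s t, 0 <= s <= 1 -> 0 <= t <= 1 -> ~~ sup_close n.+1%:R^-1 (f s) (g t).
Proof.
move=> cf cg fg.
suff: exists n, forall s, 0 <= s <= 1 ->
    forall t, 0 <= t <= 1 -> ~~ sup_close n.+1%:R^-1 (f s) (g t).
  by case=> n H; exists n => s t s01 t01; exact: H.
apply: compact01_unif.
  move=> s n m nm H t t01; apply: contraNN (H t t01); apply: sup_close_le.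
  exact: inv_succ_le.
move=> s s01.
(* Second use of compactness, now in [t]; the statement covers all [s'] near [s], as the outer use
   needs a bound valid on a neighbourhood. *)
have [|t t01|n H] := @compact01_unif R (fun t n => forall s', 0 <= s' <= 1 ->
    `|s - s'| < n.+1%:R^-1 -> ~~ sup_close n.+1%:R^-1 (f s') (g t)).
- move=> t n m nm H s' s'01 ss'; apply: contraNN (H s' s'01 _).
    by apply: sup_close_le; exact: inv_succ_le.
  by apply: lt_le_trans ss' _; exact: inv_succ_le.
(* The distance of the two points; one third of it is allowed for moving [s], for moving [t] and for
   the closeness to be refuted. *)
- pose D := Num.max `|(f s).1 - (g t).1| `|(f s).2 - (g t).2|.
  have D0 : 0 < D.
    rewrite lt_max !normr_gt0 !subr_eq0 -negb_and.
    apply/negP => /andP[/eqP e1 /eqP e2]; apply: (fg s t) => //.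
    by rewrite [LHS]surjective_pairing e1 e2 -surjective_pairing.
  have D30 : 0 < D / 3 by lra.
  have [r r0 H] := cf s s01 _ D30; have [r' r'0 H'] := cg t t01 _ D30.
  have mr : 0 < Num.min r (D / 3) by rewrite lt_min r0.
  have [n] := exists_inv_lt mr; rewrite lt_min => /andP[nr nD].
  exists n, r' => // t' t'01 tt' s' s'01 ss'; apply/negP => C.
  have C1 : sup_close (D / 3) (f s') (g t') by apply: sup_close_le C; exact: ltW.
  have := H s' s'01 (lt_trans ss' nr) => C2.
  have := sup_close_trans (sup_close_trans C2 C1) (eqbLR (sup_closeC _ _ _) (H' t' t'01 tt')).
  have -> : D / 3 + D / 3 + D / 3 = D by field.
  rewrite /sup_close => /andP[h1 h2].
  have : D < D by rewrite {1}/D gt_max h1 h2.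
  by rewrite ltxx.
exists n, n.+1%:R^-1; first by rewrite invr_gt0 ltr0Sn.
by move=> s' s'01 ss' t t01; apply: H.
Qed.

Lemma cont01_affine (R : realType) (f : R -> R * R) (a b : R) :
  0 <= a <= 1 -> 0 <= a + b <= 1 -> cont01 f -> cont01 (fun t => f (a + b * t)).
Proof.
move=> a01 ab01 cf s s01 d d0.
have in01 t : 0 <= t <= 1 -> 0 <= a + b * t <= 1.
  by move=> /andP[t0 t1]; apply/andP; split; nra.
have [r r0 H] := cf _ (in01 s s01) d d0.
have b1 : 0 < `|b| + 1 by rewrite ltr_wpDl.
exists (r / (`|b| + 1)); first by rewrite divr_gt0.
move=> t t01; rewrite ltr_pdivlMr // => st; apply: H; first exact: in01.
have -> : a + b * s - (a + b * t) = (s - t) * b by ring.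
rewrite normrM; apply: le_lt_trans st; apply: ler_wpM2l => //; lra.
Qed.

Definition pixel (R : realType) (B h : R) (p : R * R) : nat * nat :=
  (Num.truncn ((p.1 + B) / h), Num.truncn ((p.2 + B) / h)).

(** King moves, including staying put. *)
Definition near_pix (u w : nat * nat) : bool :=
  [&& u.1 <= w.1.+1, w.1 <= u.1.+1, u.2 <= w.2.+1 & w.2 <= u.2.+1]%N.

Lemma near_pix_walk a b : near_pix a b ->
  exists q, [/\ path grid_adj a q, last a q = b & forall u, u \in q -> near_pix u b].
Proof.
rewrite /near_pix; case: a b => [i j] [i' j'] /=.
have [<-|ni] := eqVneq i i'; have [<-|nj] := eqVneq j j' => H.
- by exists [::].
- exists [:: (i, j')]; rewrite /= grid_adjE /=; split=> //; first lia.
  by move=> u; rewrite inE => /eqP -> /=; lia.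
- exists [:: (i', j)]; rewrite /= grid_adjE /=; split=> //; first lia.
  by move=> u; rewrite inE => /eqP -> /=; lia.
exists [:: (i', j); (i', j')]; rewrite /= !grid_adjE /=; split=> //; first lia.
by move=> u; rewrite !inE => /orP[] /eqP -> /=; lia.
Qed.

Lemma truncn_close (R : realType) (h x y : R) : 0 < h -> 0 <= x -> 0 <= y ->
  `|x - y| < h -> (Num.truncn (x / h) <= (Num.truncn (y / h)).+1)%N.
Proof.
move=> h0 x0 y0 xy; rewrite truncn_le_nat.
have /andP[_ lt] := truncn_itv (divr_ge0 y0 (ltW h0)).
rewrite ltr_pdivrMr //; move: lt; rewrite ltr_pdivrMr // => lt.
rewrite -addn1 natrD mulrDl mul1r; move: xy; rewrite ltr_norml => /andP[_ xy].
lra.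
Qed.

Lemma truncn_far (R : realType) (h x y : R) : 0 < h -> 0 <= x -> 0 <= y ->
  (Num.truncn (x / h) <= (Num.truncn (y / h)).+2)%N -> x - y < 3 * h.
Proof.
move=> h0 x0 y0; rewrite -(ler_nat R).
have /andP[ly _] := truncn_itv (divr_ge0 y0 (ltW h0)).
have /andP[_ lx] := truncn_itv (divr_ge0 x0 (ltW h0)).
move: lx ly; rewrite ltr_pdivrMr // ler_pdivlMr //.
rewrite -addn2 -addn1 !natrD; nra.
Qed.

Lemma sup_close0_ge0 (R : realType) (B : R) p : sup_close B p 0 -> 0 <= p.1 + B /\ 0 <= p.2 + B.
Proof.
by rewrite /sup_close !subr0 !ltr_norml => /andP[/andP[a _] /andP[b _]]; split; lra.
Qed.

Lemma pixel_close (R : realType) (B h : R) p q : 0 < h ->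
  sup_close B p 0 -> sup_close B q 0 -> sup_close h p q -> near_pix (pixel B h p) (pixel B h q).
Proof.
move=> h0 /sup_close0_ge0[p1 p2] /sup_close0_ge0[q1 q2] /andP[c1 c2].
have E x y : x - y = x + B - (y + B) by ring.
rewrite E in c1; rewrite E in c2; rewrite /near_pix /=.
apply/and4P; split; apply: truncn_close => //; by rewrite distrC.
Qed.

(** Through [u], the two pixels differ by at most 2 in each coordinate, which leaves less than three
    pixel widths between the points. *)
Lemma pixel_far (R : realType) (B h : R) p q u : 0 < h ->
    sup_close B p 0 -> sup_close B q 0 ->
    near_pix u (pixel B h p) -> near_pix u (pixel B h q) ->
  sup_close (3 * h) p q.
Proof.
move=> h0 /sup_close0_ge0[p1 p2] /sup_close0_ge0[q1 q2].
move=> /and4P[/= a1 a2 a3 a4] /and4P[/= b1 b2 b3 b4].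
have D x y : 0 <= x + B -> 0 <= y + B ->
    (Num.truncn ((x + B) / h) <= (Num.truncn ((y + B) / h)).+2)%N ->
    (Num.truncn ((y + B) / h) <= (Num.truncn ((x + B) / h)).+2)%N ->
    `|x - y| < 3 * h.
  move=> x0 y0 xy yx; have -> : x - y = x + B - (y + B) by ring.
  rewrite ltr_norml ltrNl opprB.
  by apply/andP; split; apply: truncn_far.
by apply/andP; split; apply: D => //; lia.
Qed.

Lemma pixel_walk (R : realType) (B h : R) (f : R -> R * R) : 0 < h ->
    cont01 f -> (forall t, 0 <= t <= 1 -> sup_close B (f t) 0) ->
  exists p, [/\ path grid_adj (pixel B h (f 0)) p, last (pixel B h (f 0)) p = pixel B h (f 1)
    & forall u, u \in pixel B h (f 0) :: p ->
        exists2 t, 0 <= t <= 1 & near_pix u (pixel B h (f t))].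
Proof.
move=> h0 cf bf; have [n nP] := curve_unif cf h0.
have nearxx a : near_pix a a by rewrite /near_pix; lia.
(* With [n.+2] equal steps, consecutive times are strictly closer than the modulus [n.+1%:R^-1]. *)
pose tm k : R := k%:R / n.+2%:R.
have tm01 k : (k <= n.+2)%N -> 0 <= tm k <= 1.
  move=> kn; rewrite /tm divr_ge0 ?ler0n //= ler_pdivrMr ?ltr0Sn // mul1r ler_nat //.
have main k : (k <= n.+2)%N -> exists p,
    [/\ path grid_adj (pixel B h (f 0)) p, last (pixel B h (f 0)) p = pixel B h (f (tm k))
    & forall u, u \in pixel B h (f 0) :: p ->
        exists2 t, 0 <= t <= 1 & near_pix u (pixel B h (f t))].
  elim: k => [_|k IH kn].
    exists [::]; split; rewrite /tm ?mul0r //= => u; rewrite inE => /eqP ->.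
    by exists 0; rewrite ?lexx ?ler01.
  have [p [pp pl pn]] := IH (ltnW kn).
  have st : near_pix (pixel B h (f (tm k))) (pixel B h (f (tm k.+1))).
    apply: pixel_close => //; try by apply: bf; apply: tm01; rewrite // ltnW.
    apply: nP; try by apply: tm01; rewrite // ltnW.
    rewrite /tm -mulrBl -[k.+1]addn1 natrD opprD addrA subrr add0r mulN1r normrN.
    by rewrite ger0_norm ?invr_ge0 ?ler0n // ltf_pV2 ?posrE ?ltr0Sn // ltr_nat.
  have [q [qp ql qn]] := near_pix_walk st.
  exists (p ++ q); split; rewrite ?cat_path ?last_cat ?pp ?pl //.
  move=> u; rewrite -cat_cons mem_cat => /orP[/pn //|/qn un].
  by exists (tm k.+1); first exact: tm01.
by have := main n.+2 (leqnn _); rewrite /tm divff // pnatr_eq0.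
Qed.

Lemma finite_uniform (I : finType) (P : I -> nat -> Prop) :
    (forall i n m, (n <= m)%N -> P i n -> P i m) -> (forall i, exists n, P i n) ->
  exists n, forall i, P i n.
Proof.
move=> mono /fin_all_exists [f fP]; exists (\max_i f i) => i.
by apply: mono (fP i); apply: leq_bigmax.
Qed.

Lemma planar_grid_minor (T : finType) (e : rel T) :
  simple_graph e -> planar e -> grid_minor e.
Proof.
move=> simp [pos [arc [pos_inj [arcP [arc_avoid arc_dis]]]]].
pose R : realType := Rdefinitions.R; have [sym irr] := simp.
pose lt (x y : T) := (enum_rank x < enum_rank y)%N.
have ltN x y : e x y -> ~~ lt x y -> lt y x.
  rewrite /lt -leqNgt leq_eqVlt => xy /orP[/eqP/val_inj/enum_rank_inj E|//].
  by rewrite E irr in xy.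
have arc_cont x y : e x y -> cont01 (arc x y).
  by move=> /arcP[? _ _ _]; exact: cont01_within.
have arc0 x y : e x y -> arc x y 0 = pos x by move=> /arcP[].
have arc1 x y : e x y -> arc x y 1 = pos y by move=> /arcP[].
have arc_inj x y (s t : R) : e x y -> 0 <= s <= 1 -> 0 <= t <= 1 ->
    arc x y s = arc x y t -> s = t.
  by move=> /arcP[_ inj _ _] s01 t01; apply: inj; rewrite in_itv.
have endpoint_or_interior (a : R) : 0 <= a <= 1 -> [\/ a = 0, a = 1 | 0 < a < 1].
  move=> /andP[]; rewrite !le_eqVlt => /orP[/eqP<-|a0]; first by constructor 1.
  move=> /orP[/eqP->|a1]; first by constructor 2.
  by constructor 3; rewrite a0.
(* Only arcs directed along [lt] are used, because [arc p q] and [arc q p] may be different curves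
   that meet each other. Two such arcs meet in a common parameter of one edge or in a shared end
   vertex. *)
have meet p q p' q' (a a' : R) : e p q -> e p' q' -> lt p q -> lt p' q' ->
    0 <= a <= 1 -> 0 <= a' <= 1 -> arc p q a = arc p' q' a' ->
    [/\ p = p', q = q' & a = a'] \/
    [/\ a = 0 \/ a = 1, a' = 0 \/ a' = 1 & (if a == 0 then p else q) = (if a' == 0 then p' else q')].
  move=> pq pq' lpq lpq' a01 a01' E.
  have bd (r s : T) (b : R) : e r s -> b = 0 \/ b = 1 -> arc r s b = pos (if b == 0 then r else s).
    by move=> rs [] ->; rewrite ?eqxx ?oner_eq0 ?arc0 ?arc1.
  have inn (b : R) : 0 <= b <= 1 -> (b = 0 \/ b = 1) \/ 0 < b < 1.
    by move=> /endpoint_or_interior[]; auto.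
  have [ae|ai] := inn a a01; have [ae'|ai'] := inn a' a01'.
  - right; split=> //; apply: pos_inj; by rewrite -!bd.
  - by case: (arc_avoid _ _ _ pq' ai' (if a == 0 then p else q)); rewrite -bd.
  - by case: (arc_avoid _ _ _ pq ai (if a' == 0 then p' else q')); rewrite -bd.
  left; case: (arc_dis _ _ _ _ _ _ pq pq' ai ai' E) => [] [pE qE]; subst.
    by split=> //; exact: arc_inj E.
  by have := ltn_trans lpq lpq'; rewrite ltnn.
(* [x] owns the first half of an arc that starts at [x] and the last quarter of
   an arc that ends at [x]; [k] is the connecting piece. *)
pose g x y : R -> R * R := if lt x y then fun t => arc x y (0 + 1/2 * t)
  else fun t => arc y x (1 + (- (1/4)) * t).
pose k x y : R -> R * R := fun t => arc x y (1/2 + 1/4 * t).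
have gcont x y : e x y -> cont01 (g x y).
  move=> xy; rewrite /g; case: ifP => _; apply: cont01_affine; try lra.
    exact: arc_cont.
  by apply: arc_cont; rewrite sym.
have kcont x y : e x y -> cont01 (k x y).
  by move=> xy; apply: cont01_affine; [lra|lra|exact: arc_cont].
have gpt x y (s : R) : e x y -> 0 <= s <= 1 -> exists p q (a : R),
    [/\ e p q, lt p q, 0 <= a <= 1, g x y s = arc p q a
     & [/\ p = x, q = y & a <= 1/2] \/ [/\ p = y, q = x & 3/4 <= a]].
  move=> xy s01; rewrite /g; case: ifP => [l|/negbT nl].
    by exists x, y, (0 + 1/2 * s); split=> //; [lra|left; split=> //; lra].
  exists y, x, (1 + (- (1/4)) * s); rewrite sym; split=> //; first exact: ltN.
    by lra.
  by right; split=> //; lra.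
have D1 x y x' y' (s t : R) : e x y -> e x' y' -> 0 <= s <= 1 -> 0 <= t <= 1 ->
    g x y s = g x' y' t -> x = x'.
  move=> xy xy' s01 t01.
  have [p [q [a [pq lpq a01 -> aP]]]] := gpt _ _ _ xy s01.
  have [p' [q' [a' [pq' lpq' a01' -> aP']]]] := gpt _ _ _ xy' t01.
  move=> /(meet _ _ _ _ _ _ pq pq' lpq lpq' a01 a01')[[pE qE aE]|[]].
    case: aP => -[? ? ?]; case: aP' => -[? ? ?]; subst=> //; exfalso; lra.
  have fin (r r' z w : T) (b : R) : b = 0 \/ b = 1 ->
      [/\ r = z, r' = w & b <= 1/2] \/ [/\ r = w, r' = z & 3/4 <= b] ->
      (if b == 0 then r else r') = z.
    by move=> [] -> [] [-> -> H]; rewrite ?eqxx ?oner_eq0 //; exfalso; lra.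
  by move=> ae ae'; rewrite (fin _ _ x y) // (fin _ _ x' y').
(* Connecting pieces have arc parameters between 1/2 and 3/4, which rules out the end vertices in
   [meet]. *)
have D2 x y z w (s t : R) : e x y -> lt x y -> e z w -> 0 <= s <= 1 -> 0 <= t <= 1 ->
    k x y s = g z w t -> z = x \/ z = y.
  move=> xy l zw s01 t01.
  have [p [q [a [pq lpq a01 -> aP]]]] := gpt _ _ _ zw t01.
  have a01' : 0 <= 1/2 + 1/4 * s <= 1 by lra.
  move=> /(meet _ _ _ _ _ _ xy pq l lpq a01' a01)[[pE qE _]|[[] ? _ _]]; try (exfalso; lra).
  by case: aP => -[pz qz _]; [left; rewrite pE pz|right; rewrite qE qz].
have D3 x y z w (s t : R) : e x y -> lt x y -> e z w -> lt z w ->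
    0 <= s <= 1 -> 0 <= t <= 1 -> k x y s = k z w t -> x = z.
  move=> xy l zw l' s01 t01.
  have a01 : 0 <= 1/2 + 1/4 * s <= 1 by lra.
  have a01' : 0 <= 1/2 + 1/4 * t <= 1 by lra.
  by move=> /(meet _ _ _ _ _ _ xy zw l l' a01 a01')[[]//|[[] ? _ _]]; exfalso; lra.
have [N0 N0P] : exists n, forall i : T * T, e i.1 i.2 ->
    forall s : R, 0 <= s <= 1 -> sup_close n%:R (arc i.1 i.2 s) 0.
  apply: finite_uniform => [i n m nm H xy s s01|[x y]] /=.
    by apply: sup_close_le (H xy s s01); rewrite ler_nat.
  case: (boolP (e x y)) => [/arc_cont/curve_bounded[n H]|_]; last by exists 0%N.
  by exists n.
pose sep (n : nat) (f g : R -> R * R) := forall s t : R, 0 <= s <= 1 -> 0 <= t <= 1 ->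
  ~~ sup_close n.+1%:R^-1 (f s) (g t).
have sep_le n m (f f' : R -> R * R) : (n <= m)%N -> sep n f f' -> sep m f f'.
  move=> nm H s t s01 t01; apply: contraNN (H s t s01 t01).
  by apply: sup_close_le; exact: inv_succ_le.
have apart (P : Prop) (f f' : R -> R * R) : (P -> cont01 f) -> (P -> cont01 f') ->
    (P -> forall s t, 0 <= s <= 1 -> 0 <= t <= 1 -> f s <> f' t) ->
    exists n, P -> sep n f f'.
  move=> cf cf' ff; have [p|np] := pselect P; last by exists 0%N.
  by have [n nP] := curves_apart (cf p) (cf' p) (ff p); exists n.
have [N1 N1P] : exists n, forall i : (T * T) * (T * T),
    [/\ e i.1.1 i.1.2, e i.2.1 i.2.2 & i.1.1 <> i.2.1] ->
    sep n (g i.1.1 i.1.2) (g i.2.1 i.2.2).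
  apply: finite_uniform => [i n m nm H /H|[[x y] [x' y']]] /=; first exact: sep_le.
  apply: apart => [[xy _ _]|[_ xy _]|[xy xy' nx] s t s01 t01 E]; try exact: gcont.
  by apply: nx; exact: D1 E.
have [N2 N2P] : exists n, forall i : (T * T) * (T * T),
    [/\ e i.1.1 i.1.2, lt i.1.1 i.1.2, e i.2.1 i.2.2 & i.2.1 <> i.1.1 /\ i.2.1 <> i.1.2] ->
    sep n (k i.1.1 i.1.2) (g i.2.1 i.2.2).
  apply: finite_uniform => [i n m nm H /H|[[x y] [x' y']]] /=; first exact: sep_le.
  apply: apart => [[xy _ _ _]|[_ _ xy _]|[xy l xy' [n1 n2]] s t s01 t01 E];
    [exact: kcont|exact: gcont|].
  by have [] := D2 _ _ _ _ _ _ xy l xy' s01 t01 E.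
have [N3 N3P] : exists n, forall i : (T * T) * (T * T),
    [/\ e i.1.1 i.1.2, lt i.1.1 i.1.2, e i.2.1 i.2.2, lt i.2.1 i.2.2 & i.1.1 <> i.2.1] ->
    sep n (k i.1.1 i.1.2) (k i.2.1 i.2.2).
  apply: finite_uniform => [i n m nm H /H|[[x y] [x' y']]] /=; first exact: sep_le.
  apply: apart => [[xy _ _ _ _]|[_ _ xy _ _]|[xy l xy' l' n1] s t s01 t01 E];
    [exact: kcont|exact: kcont|].
  exact: n1 (D3 _ _ _ _ _ _ xy l xy' l' s01 t01 E).
pose N := maxn N1 (maxn N2 N3).
have NN1 : (N1 <= N)%N by rewrite /N; lia.
have NN2 : (N2 <= N)%N by rewrite /N; lia.
have NN3 : (N3 <= N)%N by rewrite /N; lia.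
(* Walks sharing a grid point come from curve points closer than [3 * h], which is the common
   separation distance; [B] bounds the whole drawing. *)
pose h : R := N.+1%:R^-1 / 3; pose B : R := N0%:R.
have h0 : 0 < h by rewrite divr_gt0 // invr_gt0 ltr0Sn.
have h3 : 3 * h = N.+1%:R^-1 by rewrite /h mulrC divfK ?pnatr_eq0.
have gB x y : e x y -> forall t, 0 <= t <= 1 -> sup_close B (g x y t) 0.
  move=> xy t t01; rewrite /g; case: ifP => _.
    by apply: (N0P (x, y)) => //; lra.
  by apply: (N0P (y, x)); rewrite /= 1?sym //; lra.
have kB x y : e x y -> forall t, 0 <= t <= 1 -> sup_close B (k x y t) 0.
  by move=> xy t t01; apply: (N0P (x, y)) => //; lra.
have hit (f f' : R -> R * R) u : (forall t, 0 <= t <= 1 -> sup_close B (f t) 0) ->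
    (forall t, 0 <= t <= 1 -> sup_close B (f' t) 0) -> sep N f f' ->
    (exists2 t, 0 <= t <= 1 & near_pix u (pixel B h (f t))) ->
    (exists2 t, 0 <= t <= 1 & near_pix u (pixel B h (f' t))) -> False.
  move=> fB fB' sp [s s01 us] [t t01 ut].
  have /negP := sp s t s01 t01; apply; rewrite -h3.
  exact: pixel_far h0 (fB s s01) (fB' t t01) us ut.
have walk (f : T * T -> R -> R * R) : exists W : T * T -> seq (nat * nat), forall i,
   cont01 (f i) -> (forall t, 0 <= t <= 1 -> sup_close B (f i t) 0) ->
   [/\ path grid_adj (pixel B h (f i 0)) (W i), last (pixel B h (f i 0)) (W i) = pixel B h (f i 1)
    & forall u, u \in pixel B h (f i 0) :: W i ->
        exists2 t, 0 <= t <= 1 & near_pix u (pixel B h (f i t))].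
  apply: (@fin_all_exists _ _ (fun i W => cont01 (f i) ->
    (forall t, 0 <= t <= 1 -> sup_close B (f i t) 0) -> [/\ path grid_adj (pixel B h (f i 0)) W,
    last (pixel B h (f i 0)) W = pixel B h (f i 1) & forall u, u \in pixel B h (f i 0) :: W ->
        exists2 t, 0 <= t <= 1 & near_pix u (pixel B h (f i t))])) => i.
  have [[cf fB]|nf] := pselect (cont01 (f i) /\ (forall t, 0 <= t <= 1 -> sup_close B (f i t) 0)).
    by have [W WP] := pixel_walk h0 cf fB; exists W.
  by exists [::] => cf fB; case: nf.
have [A AP] := walk (fun i => g i.1 i.2); have [K KP] := walk (fun i => k i.1 i.2).
have g0 x y : e x y -> g x y 0 = pos x.
  move=> xy; rewrite /g; case: ifP => _; rewrite mulr0 addr0 ?arc0 ?arc1 //.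
  by rewrite sym.
have gk0 x y : e x y -> lt x y -> g x y 1 = k x y 0.
  by move=> xy l; rewrite /g l /k; congr arc; lra.
have gk1 x y : e x y -> lt x y -> g y x 1 = k x y 1.
  move=> xy l; rewrite /g /k; case: ifP => [l'|_]; last by congr arc; lra.
  by have := ltn_trans l l'; rewrite ltnn.
have AP' x y (xy : e x y) := AP (x, y) (gcont x y xy) (gB x y xy).
have KP' x y (xy : e x y) := KP (x, y) (kcont x y xy) (kB x y xy).
apply: (@walks_grid_minor T e (fun x => pixel B h (pos x)) (fun x y => pixel B h (g x y 1))
  (fun x y => A (x, y)) (fun x y => K (x, y)) simp).
- by move=> x y xy; have /= [] := AP' x y xy; rewrite g0.
- by move=> x y xy l; have /= [] := KP' x y xy; rewrite -gk0 // -gk1.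
- move=> x y x' y' u xy xy' uA uA'; apply: contrapT => nx.
  have /= [_ _] := AP' x y xy; rewrite g0 // => /(_ u uA) h1.
  have /= [_ _] := AP' x' y' xy'; rewrite g0 // => /(_ u uA') h2.
  apply: (hit _ _ u (gB x y xy) (gB x' y' xy') _ h1 h2).
  by apply: sep_le NN1 _; apply: (N1P ((x, y), (x', y'))).
- move=> x y z w u xy l zw uK uA; apply: contrapT => /not_orP[n1 n2].
  have /= [_ _] := KP' x y xy; rewrite -gk0 // => /(_ u uK) h1.
  have /= [_ _] := AP' z w zw; rewrite g0 // => /(_ u uA) h2.
  apply: (hit _ _ u (kB x y xy) (gB z w zw) _ h1 h2).
  by apply: sep_le NN2 _; apply: (N2P ((x, y), (z, w))).
move=> x y x' y' u xy l xy' l' uK uK'; apply: contrapT => nx.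
have /= [_ _] := KP' x y xy; rewrite -gk0 // => /(_ u uK) h1.
have /= [_ _] := KP' x' y' xy'; rewrite -gk0 // => /(_ u uK') h2.
apply: (hit _ _ u (kB x y xy) (kB x' y' xy') _ h1 h2).
by apply: sep_le NN3 _; apply: (N3P ((x, y), (x', y'))).
Qed.

Local Close Scope classical_set_scope.
Local Close Scope ring_scope.

(** * The surviving rate *)

(** The drawing restricts to the induced subgraph and cycles map injectively into [T], so the
    sparsity bound applies to the subtype of [W]. *)
Lemma planar_sum_deg_sub (T : finType) (e : rel T) (W : {set T}) :
  simple_graph e -> planar e -> girth_ge e 5 ->
  (3 * \sum_(x in W) #|[set y in W | e x y]| <= 10 * #|W|)%N.
Proof.
move=> [sym irr] [pos [arc [pos_inj [arcP [arc_avoid arc_dis]]]]] girth.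
pose e' : rel {x in W} := relpre val e.
have simp' : simple_graph e' by split=> [x y|x] /=; [exact: sym|exact: irr].
have planar' : planar e'.
  exists (fun x => pos (val x)), (fun x y => arc (val x) (val y)); split.
    by move=> x y /pos_inj/val_inj.
  split; first by move=> x y; exact: arcP.
  split; first by move=> x y t xy t01 z; exact: arc_avoid xy t01 _.
  move=> x y x' y' t t' xy xy' t01 t01' E.
  by case: (arc_dis _ _ _ _ _ _ xy xy' t01 t01' E) => -[/val_inj-> /val_inj->]; auto.
have girth' : girth_ge e' 5.
  move=> p up sp cp; rewrite -(size_map val); apply: girth.
  - by rewrite map_inj_uniq //; exact: val_inj.
  - by rewrite size_map.
  by rewrite cycle_map.
have := grid_minor_sum_deg simp' girth' (planar_grid_minor simp' planar').
rewrite card_sig (_ : #|[pred x | x \in W]| = #|W|); last exact: eq_card.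
apply: leq_trans; rewrite leq_mul2l /= big_sub; apply: eq_leq.
apply: eq_bigr => x _; rewrite -[RHS](card_imset _ val_inj).
apply: eq_card => y; rewrite !inE; apply/andP/imsetP => [[yW xy]|[z xz ->]].
  by exists (Sub y yW).
by split; [exact: valP|exact: xz].
Qed.

Theorem theorem2 (T : finType) (e : rel T) :
  simple_graph e -> planar e -> girth_ge e 5 -> (2 <= #|T|)%N ->
  ((1 / 22 : rat) <= surviving_rate e 2)%R.
Proof.
move=> simp planar_e girth n2; have [sym irr] := simp.
suff bound : (#|T| ^ 2 <= 22 * \sum_(v : T) sn e 2 v)%N.
  have n0 : (0 < (#|T| ^ 2)%:R :> rat)%R by rewrite ltr0n expn_gt0 (ltnW n2).
  have p22 : (0 < 22%:R :> rat)%R by rewrite ltr0n.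
  rewrite /surviving_rate (ler_pdivlMr _ _ n0) mul1r (ler_pdivrMl _ _ p22).
  by rewrite -natrM ler_nat.
have sn_min (k : nat) (v : T) : (k <= 2)%N -> (k < #|T|)%N -> (k <= sn e 2 v)%N.
  move=> k2 kT; pose P := [set x in take k (enum [set~ v])].
  have cP : #|P| = k.
    rewrite cardsE (card_uniqP _) ?take_uniq ?enum_uniq // size_takel //.
    by rewrite -cardE cardsC1; lia.
  rewrite -cP; apply: sn_protect; first by rewrite cP.
  by rewrite inE; apply/negP => /mem_take; rewrite mem_enum !inE eqxx.
have sum_ge (k : nat) : (forall v, k <= sn e 2 v)%N -> (#|T| * k <= \sum_(v : T) sn e 2 v)%N.
  by move=> H; rewrite -sum_nat_const; apply: leq_sum.
have [n2'|n3] := leqP #|T| 2.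
  have := sum_ge 1%N (fun v => sn_min 1%N v isT n2); nia.
(* Two saved vertices per start give [22 * 2 * #|T|], at least the square of [#|T|] in this
   range. *)
have [n44|n45] := leqP #|T| 44.
  have := sum_ge 2%N (fun v => sn_min 2%N v isT n3); nia.
pose W := [set x | 1 < #|e x|]%N.
pose A := [set x | (#|e x| <= 2) || (#|e x| == 3) && [exists y, e x y && (#|e y| <= 3)]]%N.
have TA : (#|T| <= 15 * #|A|)%N.
  exact: (card_le_15_good sym irr (erefl W) (erefl A) (planar_sum_deg_sub _ simp planar_e girth)).
have snA v : v \in A -> (#|T| - 2 <= sn e 2 v)%N.
  rewrite inE => /orP[d2|/andP[/eqP d3 /existsP[y /andP[vy dy]]]].
    by apply: leq_trans (sn_deg_le irr d2); apply: leq_sub2l.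
  by apply: (sn_deg_next sym irr vy) => //; rewrite d3.
have : (#|A| * (#|T| - 2) <= \sum_(v : T) sn e 2 v)%N.
  rewrite -sum_nat_const [leqLHS]big_mkcond; apply: leq_sum => v _.
  by case: ifP => // /snA.
(* By [TA] it is enough that [15 * #|T| <= 22 * (#|T| - 2)], which holds from 7 vertices on. *)
nia.
Qed.
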